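(* Let $\alpha\in(0,1)\setminus\mathbb{Q}$ and let $\phi(x)=\frac1x+\frac1{1-x}$. If $\sum_{n\ge 1}W_n(\alpha)<\infty$, then for Lebesgue-almost every $x\in\mathbb{T}$ $$\limsup_{N\to\infty}\frac{\phi(R_\alpha^N x)}{S_N(\phi)(x)}=0 .$$ If $\sum_{n\ge 1}W_n(\alpha)=\infty$, then for Lebesgue-almost every $x\in\mathbb{T}$ $$\limsup_{N\to\infty}\frac{\phi(R_\alpha^N x)}{S_N(\phi)(x)}=\infty .$$
   Context: $\mathbb{T}=\mathbb{R}/\mathbb{Z}$ is the one-torus, identified with $[0,1)$ and equipped with Lebesgue measure; $R_\alpha(x)=x+\alpha \bmod 1$. The function $\phi$ is defined on $\mathbb{T}$ by $\phi(x)=\frac1x+\frac1{1-x}$ for $x\in(0,1)$ (its value at the single point $0$ is irrelevant for almost everywhere statements). For $N\geq 1$, $S_N(\phi)(x)=\sum_{k=0}^{N-1}\phi(R_\alpha^k x)$. Let $\alpha=[a_1,a_2,\ldots]$ be the continued fraction expansion of $\alpha$ with $a_j\in\mathbb{N}$, $j\ge1$, and let $q_n$ be the denominators of its convergents: $q_{-1}=0$, $q_0=1$, $q_{n+1}=a_{n+1}q_n+q_{n-1}$. Define $$W_n=W_n(\alpha)=\begin{cases}\dfrac{\log q_{n+1}-\log q_n}{\log q_n}&\text{if } q_{n+1}<2q_n\log q_n,\\[2ex] \dfrac{\max\left\{1,\ \log\log q_n-\log\log\frac{q_{n+1}}{q_n\log q_n}\right\}}{\log q_n}&\text{if } q_{n+1}\ge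 2q_n\log q_n,\end{cases}$$ for $n\ge1$ with $q_n\ge2$; a term with $q_n=1$ (possible only for $n=1$) is omitted from the sum. *)

(* Defs.v *)
From mathcomp Require Import all_boot all_order all_algebra.
From mathcomp Require Import all_classical all_reals all_analysis.

Set Implicit Arguments.
Unset Strict Implicit.
Unset Printing Implicit Defensive.

Import Order.TTheory GRing.Theory Num.Theory.
Local Open Scope ring_scope.

Definition frac {R : realType} (x : R) : R := x - (Num.floor x)%:~R.

(* The torus R/Z is represented by `[0, 1[, hence the reduction mod 1. *)
Definition rotation {R : realType} (alpha x : R) : R := frac (x + alpha).

(* Since 0^-1 = 0, this gives phi 0 = 1; that value is immaterial. *)
Definition phi {R : realType} (x : R) : R := x^-1 + (1 - x)^-1.

Definition birkhoff_sum {R : realType} (alpha : R) (f : R -> R) (N : nat)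
    (x : R) : R :=
  \sum_(0 <= k < N) f (iter k (rotation alpha) x).

(* For irrational alpha in ]0, 1[ the expansion [a_1, a_2, ...] is read off the
   orbit of the Gauss map x |-> frac (1 / x): a_j is the integer part of
   1 / x_(j-1), where x_0 = alpha. The value at j = 0 is not used. *)
Definition gauss_map {R : realType} (x : R) : R := frac x^-1.

Definition partial_quotient {R : realType} (alpha : R) (j : nat) : nat :=
  Num.truncn (iter j.-1 gauss_map alpha)^-1.

(* The pair (q_(n-1), q_n), starting from q_(-1) = 0 and q_0 = 1. *)
Fixpoint denominators {R : realType} (alpha : R) (n : nat) : nat * nat :=
  if n is m.+1 then
    let: (q', q) := denominators alpha m in
    (q, (partial_quotient alpha m.+1 * q + q')%N)
  else (0%N, 1%N).

Definition denominator {R : realType} (alpha : R) (n : nat) : nat :=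
  (denominators alpha n).2.

Definition W {R : realType} (alpha : R) (n : nat) : R :=
  let q : R := (denominator alpha n)%:R in
  let q' : R := (denominator alpha n.+1)%:R in
  if q' < 2 * q * ln q then (ln q' - ln q) / ln q
  else Num.max 1 (ln (ln q) - ln (ln (q' / (q * ln q)))) / ln q.

(* The terms are nonnegative, so the series has a value in [0, +oo]. *)
Definition W_sum {R : realType} (alpha : R) : \bar R :=
  (\sum_(1 <= n <oo | (2 <= denominator alpha n)%N) (W alpha n)%:E)%E.

(* The quotient at N = 0 has a zero denominator; it does not affect the
   limsup. *)
Definition limsup_ratio {R : realType} (alpha x : R) : \bar R :=
  limn_esup (fun N : nat =>
    (phi (iter N (rotation alpha) x) / birkhoff_sum alpha phi N x)%:E).

(* Main.v *)
(* Write q, q' for two consecutive denominators, L = ln q, and S_N for the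
   Birkhoff sum. The points x + k alpha with k < q are about 1/q-spaced, so S_N
   is at least of order N L for N >= q; moreover the points N - q, N - 2q, ...
   approach N in steps of size 1/q', which forces S_N >= q' ln(N/q) as soon as
   the N-th point is close to 0. Hence phi(R^N x) >= c S_N(x) with q <= N < q'
   confines x + N alpha to an arc around 0 of length at most of order
   min(1/(N L), 1/(q' ln(N/q))). Summing these lengths over N gives at most a
   constant times W_n, and Borel-Cantelli yields the convergent half.

   For the divergent half, split the times below q' into blocks of length q. If
   x + N alpha is within 1/(K N L) of 0, where N is in a block for which N L
   dominates q' ln(N/q), or N < q, then all earlier points stay away from 0 and
   S_N <= 68 N L deterministically. The arcs of one level are disjoint, and arcs
   of different levels are quasi-independent: an arc of length r meets at most
   about 4 r q + 1 of the q arcs of a block, and the error terms 1 add up to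
   O(q) over all earlier levels. A second moment estimate then shows that the
   arcs of all large levels cover a fixed proportion of every interval, hence
   almost every point by Lebesgue's density theorem, provided the total length
   of the arcs diverges. Up to a constant W_n is at most 1/L plus the length of
   the arcs of the blocks of level n, so one of the families N < q and q <= N
   has divergent total length. *)
Require Import Defs.
From mathcomp Require Import all_boot all_order all_algebra.
From mathcomp Require Import all_classical all_reals all_analysis.
From mathcomp Require Import measurable_realfun zify ring lra.
(* MathComp's fraction.frac shadows the fractional part. *)
Import Defs.

Set Implicit Arguments.
Unset Strict Implicit.
Unset Printing Implicit Defensive.

Import Order.TTheory GRing.Theory Num.Theory.
Import numFieldNormedType.Exports.
Local Open Scope classical_set_scope.
Local Open Scope ring_scope.

(** * Continued fractions *)

Section frac_theory.
Variable R : realType.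
Implicit Types x y : R.

Lemma frac_itv x : 0 <= frac x < 1.
Proof.
by have := floor_itv x; rewrite /frac intrD => /andP[h1 h2]; apply/andP; split; lra.
Qed.

Lemma fracDz x (m : int) : frac (x + m%:~R) = frac x.
Proof.
rewrite /frac floorDrz ?intr_int// intrKfloor intrD; ring.
Qed.

Lemma frac_id x : 0 <= x < 1 -> frac x = x.
Proof.
move=> /andP[x0 x1]; rewrite /frac (@floor_def _ _ 0) ?subr0//.
by rewrite add0r x0.
Qed.

Lemma frac_eq x y (m : int) : 0 <= y < 1 -> x = y + m%:~R -> frac x = y.
Proof. by move=> y01 ->; rewrite fracDz frac_id. Qed.

Lemma iter_rotation (alpha x : R) k : 0 <= x < 1 ->
  iter k (rotation alpha) x = frac (x + k%:R * alpha).
Proof.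
move=> x01; elim: k => [|k IH]; first by rewrite mul0r addr0 frac_id.
rewrite iterS IH /rotation {2}/frac.
rewrite (_ : _ + alpha = x + k.+1%:R * alpha + (- Num.floor (x + k%:R * alpha))%:~R).
  by rewrite fracDz.
by rewrite intrN -natr1; ring.
Qed.

Lemma irrational_neq_int x (m : int) : irrational x -> x != m%:~R.
Proof.
move=> irrx; apply/eqP => xm; apply: irrx; apply/rationalP.
by exists m, 1%N; rewrite divr1.
Qed.

Lemma irrationalDz x (m : int) : irrational x -> irrational (x + m%:~R).
Proof.
move=> irrx [r _ rx]; apply: irrx; exists (r - m%:~R) => //.
by rewrite rmorphB /= ratr_int; apply/eqP; rewrite subr_eq; apply/eqP; exact: rx.
Qed.

Lemma irrationalV x : irrational x -> irrational x^-1.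
Proof.
move=> irrx [r _ rx]; apply: irrx; exists r^-1 => //.
rewrite fmorphV -[RHS]invrK; congr (_ ^-1); exact: rx.
Qed.

Lemma irrational_frac x : irrational x -> irrational (frac x).
Proof. by rewrite /frac -intrN; exact: irrationalDz. Qed.

Lemma frac_gt0 x : irrational x -> 0 < frac x.
Proof.
move=> irrx; have /andP[f0 _] := frac_itv x.
by rewrite lt_neqAle f0 andbT eq_sym (irrational_neq_int 0)//; exact: irrational_frac.
Qed.

End frac_theory.

(* The pair (p_(n-1), p_n), starting from p_(-1) = 1 and p_0 = 0. *)
Fixpoint numerators {R : realType} (alpha : R) (n : nat) : nat * nat :=
  if n is m.+1 then
    let: (p', p) := numerators alpha m in
    (p, (partial_quotient alpha m.+1 * p + p')%N)
  else (1%N, 0%N).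

Definition numerator {R : realType} (alpha : R) (n : nat) : nat :=
  (numerators alpha n).2.

Section continued_fraction.
Variables (R : realType) (alpha : R).
Hypotheses (alpha01 : 0 < alpha < 1) (alpha_irr : irrational alpha).

Local Notation x n := (iter n gauss_map alpha).
Local Notation a := (partial_quotient alpha).
Local Notation q := (denominator alpha).
Local Notation p := (numerator alpha).

Lemma gauss_orbit n : 0 < x n < 1 /\ irrational (x n).
Proof.
elim: n => [//|n [/andP[xn0 xn1] irrx]].
have irrV := irrationalV irrx.
rewrite iterS /gauss_map frac_gt0//; split; last exact: irrational_frac.
by have /andP[_ ->] := frac_itv (x n)^-1.
Qed.

Lemma partial_quotientE n : (a n.+1)%:R = (x n)^-1 - x n.+1.
Proof.
have [/andP[xn0 xn1] _] := gauss_orbit n.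
rewrite iterS /gauss_map /frac /partial_quotient /= opprB addrC subrK.
rewrite truncn_floor invr_ge0 ltW//.
by rewrite -[LHS]/((Posz `|_|%N)%:~R) gez0_abs// floor_ge0 invr_ge0 ltW.
Qed.

Lemma partial_quotient_gt0 n : (0 < a n.+1)%N.
Proof.
have [/andP[xn0 xn1] _] := gauss_orbit n.
by rewrite /partial_quotient /= truncn_gt0 invf_ge1// ltW.
Qed.

Lemma denominators_prev n : (denominators alpha n.+1).1 = q n.
Proof. by rewrite /denominator /=; case: (denominators alpha n). Qed.

Lemma numerators_prev n : (numerators alpha n.+1).1 = p n.
Proof. by rewrite /numerator /=; case: (numerators alpha n). Qed.

Lemma denominatorS n : q n.+1 = (a n.+1 * q n + (denominators alpha n).1)%N.
Proof. by rewrite /denominator /=; case: (denominators alpha n). Qed.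

Lemma numeratorS n : p n.+1 = (a n.+1 * p n + (numerators alpha n).1)%N.
Proof. by rewrite /numerator /=; case: (numerators alpha n). Qed.

Lemma convergent_det n :
  (q n)%:Z * ((numerators alpha n).1)%:Z -
  ((denominators alpha n).1)%:Z * (p n)%:Z = (-1) ^+ n.
Proof.
elim: n => [|n IH]; first by rewrite /denominator /numerator /=.
rewrite denominators_prev numerators_prev denominatorS numeratorS exprS -IH.
by rewrite !PoszD !PoszM; ring.
Qed.

(** The Gauss orbit is, up to sign, the ratio of consecutive errors e_n = q_n alpha - p_n:
    substituting e_(n-1) = - e_n / x_n in e_(n+1) = a_(n+1) e_n + e_(n-1) leaves the factor a_(n+1)
    - 1 / x_n = - x_(n+1). *)
Lemma convergent_error_prev n :
  (q n)%:R * alpha - (p n)%:R =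
  - x n * (((denominators alpha n).1)%:R * alpha - ((numerators alpha n).1)%:R).
Proof.
elim: n => [|n IH].
  by rewrite /denominator /numerator /=; ring.
have [/andP[xn0 xn1] _] := gauss_orbit n.
rewrite denominators_prev numerators_prev denominatorS numeratorS.
transitivity ((a n.+1)%:R * ((q n)%:R * alpha - (p n)%:R) +
  (((denominators alpha n).1)%:R * alpha - ((numerators alpha n).1)%:R)).
  by rewrite !natrD !natrM; ring.
have -> : ((denominators alpha n).1)%:R * alpha - ((numerators alpha n).1)%:R =
    - (x n)^-1 * ((q n)%:R * alpha - (p n)%:R).
  by rewrite IH; field; rewrite gt_eqF.
by rewrite partial_quotientE; ring.
Qed.

Lemma convergent_errorS n :
  (q n.+1)%:R * alpha - (p n.+1)%:R = - x n.+1 * ((q n)%:R * alpha - (p n)%:R).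
Proof. by rewrite convergent_error_prev denominators_prev numerators_prev. Qed.

Lemma denominator_gt0 n : (0 < q n)%N.
Proof.
elim: n => [//|n IH]; rewrite denominatorS.
by rewrite addn_gt0 muln_gt0 partial_quotient_gt0 IH.
Qed.

Lemma leq_denominatorS n : (q n <= q n.+1)%N.
Proof.
by rewrite denominatorS; have := partial_quotient_gt0 n; nia.
Qed.

Lemma leq_denominator m n : (m <= n)%N -> (q m <= q n)%N.
Proof.
elim: n => [|n IH]; first by rewrite leqn0 => /eqP->.
rewrite leq_eqVlt => /predU1P[->//|]; rewrite ltnS => /IH/leq_trans; apply.
exact: leq_denominatorS.
Qed.

Lemma leq_denominatorD n : (q n + q n.+1 <= q n.+2)%N.
Proof.
rewrite (denominatorS n.+1) denominators_prev.
by have := partial_quotient_gt0 n.+1; nia.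
Qed.

Lemma leq_denominator_id n : (n <= q n)%N.
Proof.
elim/ltn_ind: n => -[//|[|n]] IH; first exact: denominator_gt0.
have := leq_denominatorD n; have := denominator_gt0 n; have := IH n.+1 (ltnSn _).
lia.
Qed.

Lemma leq_mul_denominator n : (a n.+1 * q n <= q n.+1)%N.
Proof. by rewrite denominatorS leq_addr. Qed.

Lemma ltn_denominator_mul n : (0 < n)%N -> (q n.+1 <= (a n.+1).+1 * q n)%N.
Proof.
by case: n => // n _; rewrite (denominatorS n.+1) denominators_prev;
  have := leq_denominatorS n; lia.
Qed.

(** The denominators grow at least as fast as the Fibonacci numbers. In the second moment estimate
    this makes the rounding errors of all earlier levels comparable to a single denominator. *)
Lemma sum_denominator n : (\sum_(0 <= i < n) q i.+1 <= 3 * q n)%N.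
Proof.
case: n => [|n]; first by rewrite big_geq.
(* This form is inductive: the step from n to n + 1 amounts to q_n + q_(n+1) <= q_(n+2). *)
suff : (\sum_(0 <= i < n.+1) q i.+1 <= 2 * q n.+1 + q n)%N.
  by have := leq_denominatorS n; lia.
elim: n => [|n IH]; first by rewrite big_nat1; lia.
by rewrite big_nat_recr//=; have := leq_denominatorD n; lia.
Qed.

(** Since e_(n+1) = - x_(n+1) e_n, the product of e_n and q_(n+1) + q_n x_(n+1) equals q_(n+1) e_n -
    q_n e_(n+1), where alpha cancels and the determinant of absolute value 1 remains. *)
Lemma convergent_errorE n : `|(q n)%:R * alpha - (p n)%:R| =
  ((q n.+1)%:R + (q n)%:R * x n.+1)^-1.
Proof.
have [/andP[x0 x1] _] := gauss_orbit n.+1.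
have q1 : 0 < (q n.+1)%:R :> R by rewrite ltr0n denominator_gt0.
have q0 : 0 < (q n)%:R :> R by rewrite ltr0n denominator_gt0.
have d0 : 0 < (q n.+1)%:R + (q n)%:R * x n.+1 by rewrite addr_gt0 ?mulr_gt0.
have := congr1 (fun z : int => z%:~R : R) (convergent_det n.+1).
rewrite denominators_prev numerators_prev intrB !intrM -!pmulrn.
rewrite rmorphXn /= => det.
set D := _ - _.
have e : D * ((q n.+1)%:R + (q n)%:R * x n.+1) = - (-1) ^+ n.+1.
  have := convergent_errorS n; rewrite -/D => DS.
  have -> : D * ((q n.+1)%:R + (q n)%:R * x n.+1) =
    (q n.+1)%:R * D - (q n)%:R * (- x n.+1 * D) by ring.
  by rewrite -DS -det /D; ring.
apply: (mulIf (lt0r_neq0 d0)); rewrite mulVf ?gt_eqF//.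
by rewrite -[X in _ * X]ger0_norm ?ltW// -normrM e normrN normrX normrN1 expr1n.
Qed.

Lemma convergent_error_lt n :
  `|(q n)%:R * alpha - (p n)%:R| < (q n.+1)%:R^-1.
Proof.
have [/andP[x0 x1] _] := gauss_orbit n.+1.
rewrite convergent_errorE ltf_pV2 ?posrE ?ltrDl ?addr_gt0 ?mulr_gt0 ?ltr0n//;
  exact: denominator_gt0.
Qed.

Lemma convergent_error_gt n :
  (2 * (q n.+1)%:R)^-1 <= `|(q n)%:R * alpha - (p n)%:R|.
Proof.
have [/andP[x0 x1] _] := gauss_orbit n.+1.
have q1 : 0 < (q n.+1)%:R :> R by rewrite ltr0n denominator_gt0.
have q0 : 0 < (q n)%:R :> R by rewrite ltr0n denominator_gt0.
rewrite convergent_errorE lef_pV2 ?posrE ?addr_gt0 ?mulr_gt0//.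
have qle : (q n)%:R <= (q n.+1)%:R :> R by rewrite ler_nat leq_denominatorS.
nra.
Qed.

(* In the basis of two consecutive convergents (d, m) has coordinates u, v of
   opposite signs with u != 0, while the two errors have opposite signs. *)
Lemma best_approximation n (d : nat) (m : int) : (0 < d < q n.+1)%N ->
  (2 * (q n.+1)%:R)^-1 <= `|d%:R * alpha - m%:~R|.
Proof.
move=> /andP[d0 dq]; apply: (le_trans (convergent_error_gt n)).
have [/andP[x0 x1] _] := gauss_orbit n.+1.
have det := convergent_det n.+1; rewrite denominators_prev numerators_prev in det.
set s : int := (-1) ^+ n.+1 in det.
have ss : s * s = 1 by rewrite /s -expr2 sqrr_sign.
(* Cramer's rule; the coordinates are integers because the determinant is the sign s. *)
pose u : int := s * ((q n.+1)%:Z * m - (p n.+1)%:Z * d%:Z).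
pose v : int := s * ((p n)%:Z * d%:Z - (q n)%:Z * m).
have dE : d%:Z = u * (q n)%:Z + v * (q n.+1)%:Z.
  transitivity (s * s * d%:Z); first by rewrite ss mul1r.
  by rewrite -{2}det /u /v; ring.
have mE : m = u * (p n)%:Z + v * (p n.+1)%:Z.
  transitivity (s * s * m); first by rewrite ss mul1r.
  by rewrite -{2}det /u /v; ring.
move: u v dE mE => {s ss det} u v dE mE.
have -> : d%:R * alpha - m%:~R =
    ((q n)%:R * alpha - (p n)%:R) * (u%:~R - v%:~R * x n.+1).
  transitivity (u%:~R * ((q n)%:R * alpha - (p n)%:R) +
                v%:~R * ((q n.+1)%:R * alpha - (p n.+1)%:R)).
    have -> : d%:R = (d%:Z)%:~R :> R by rewrite -pmulrn.
    by rewrite dE [in LHS]mE !intrD !intrM -!pmulrn; ring.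
  by rewrite convergent_errorS; ring.
rewrite normrM ler_peMr//.
have q1 := denominator_gt0 n.+1; have q0 := denominator_gt0 n.
(* As 0 < d < q_(n+1), the case u = 0 is impossible, and otherwise u and - v have compatible signs,
   so that |u - v x_(n+1)| >= |u| >= 1. *)
have [u1|u0] := lerP 1 u.
  have v0 : v <= 0 by nia.
  have u1' : 1 <= u%:~R :> R by rewrite ler1z.
  have v0' : v%:~R <= 0 :> R by rewrite lerz0.
  by rewrite ger0_norm; nra.
have [uz|uN1] : u = 0 \/ u <= -1 by lia.
- exfalso; rewrite uz mul0r add0r in dE.
  by have [v1|v1] := lerP 1 v; nia.
have v1 : 1 <= v by nia.
have u1' : u%:~R <= -1 :> R by rewrite -[X in _ <= X]/((-1)%:~R) ler_int.
have v0' : 1 <= v%:~R :> R by rewrite ler1z.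
by rewrite ler0_norm; nra.
Qed.

Lemma coprime_convergent n : coprimez (p n)%:Z (q n)%:Z.
Proof.
have det := convergent_det n.
apply/coprimezP; exists (- (-1) ^+ n * ((denominators alpha n).1)%:Z,
  (-1) ^+ n * ((numerators alpha n).1)%:Z) => /=.
rewrite -[RHS](sqrr_sign int n) expr2 -[X in _ = X * _]det -det; ring.
Qed.

End continued_fraction.

(** * Sums of inverses of separated points *)

Section harmonic_sums.
Variable R : realType.

Lemma ln_ge_harmonic (m n : nat) : (m <= n)%N ->
  ln n.+1%:R - ln m.+1%:R <= \sum_(m <= j < n) j.+1%:R^-1 :> R.
Proof.
move=> mn; rewrite -(telescope_sumr (fun j => ln j.+1%:R))//.
apply: ler_sum_nat => j _.
have j0 : (0 : R) < j.+1%:R by rewrite ltr0n.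
have -> : j.+2%:R = j.+1%:R * (1 + j.+1%:R^-1) :> R.
  by rewrite mulrDr mulfV ?gt_eqF// mulr1 -natr1.
rewrite lnM ?posrE ?addr_gt0 ?invr_gt0// addrAC subrr add0r le_ln1Dx//.
by rewrite (@lt_trans _ _ 0) ?ltrN10 ?invr_gt0.
Qed.

Lemma harmonic_le_ln (m n : nat) : (0 < m <= n)%N ->
  \sum_(m <= j < n) j%:R^-1 <= 2 * (ln n%:R - ln m%:R) :> R.
Proof.
move=> /andP[m0 mn]; rewrite -(telescope_sumr (fun j => ln j%:R))// mulr_sumr.
apply: ler_sum_nat => j /andP[mj _].
have j0 : (0 : R) < j%:R by rewrite ltr0n (leq_trans m0).
have j1 : (1 : R) <= j%:R by rewrite ler1n (leq_trans m0).
have e : ln j%:R - ln j.+1%:R <= - j.+1%:R^-1 :> R.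
  rewrite -ln_div ?posrE ?ltr0Sn//.
  have -> : j%:R / j.+1%:R = 1 + - j.+1%:R^-1 :> R.
    by rewrite -natr1; field; rewrite natr1 pnatr_eq0.
  apply: le_ln1Dx; rewrite ltrN2 invf_lt1 ?ltr0n// -natr1; lra.
have : j%:R^-1 <= 2 * j.+1%:R^-1 :> R.
  rewrite ler_pdivlMr ?ltr0n// mulrC ler_pdivrMr//.
  by rewrite -[j.+1%:R]natr1; lra.
move=> /le_trans; apply; rewrite /= ler_pM2l// -[leRHS]opprB lerNr; exact: e.
Qed.

(** The entries up to M form part of a harmonic sum; the remaining ones number at most M and
    contribute at most 1 / M each. *)
Lemma sum_inv_uniq_le (s : seq nat) (M : nat) :
  uniq s -> (size s <= M)%N -> {in s, forall j, (0 < j)%N} ->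
  \sum_(j <- s) j%:R^-1 <= 2 * ln M.+1%:R + 1 :> R.
Proof.
move=> us; case: M => [|M] sM s0.
  move: sM; rewrite leqn0 size_eq0 => /eqP->.
  by rewrite big_nil ln1 mulr0 add0r ler01.
rewrite (bigID (fun j => j < M.+2)%N) /= lerD//.
  rewrite -big_filter.
  apply: (@le_trans _ _ (\sum_(1 <= j < M.+2) j%:R^-1)); last first.
    by rewrite (le_trans (harmonic_le_ln _))// ln1 subr0.
  set r := index_iota 1 M.+2; set t := [seq _ <- _ | _].
  have -> : \sum_(j <- r) j%:R^-1 =
     \sum_(j <- t) j%:R^-1 + \sum_(j <- r | j \notin t) j%:R^-1 :> R.
    rewrite (bigID (mem t)) /=; congr (_ + _).
    rewrite -big_filter; apply: perm_big; apply: uniq_perm.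
    - by rewrite filter_uniq ?iota_uniq.
    - by rewrite filter_uniq.
    - move=> j; rewrite mem_filter mem_index_iota andb_idr// /t mem_filter.
      by move=> /andP[jM /s0 ->].
  by rewrite lerDl sumr_ge0.
have : \sum_(j <- s | ~~ (j < M.+2)%N) j%:R^-1 <=
    \sum_(j <- s | ~~ (j < M.+2)%N) M.+1%:R^-1 :> R.
  apply: ler_sum => j; rewrite -leqNgt => jM.
  by rewrite lef_pV2 ?posrE ?ltr0n ?(leq_trans _ jM)// ler_nat ltnW.
move/le_trans; apply; rewrite -big_filter big_const_seq count_predT iter_addr_0.
rewrite -[X in X <= _]mulr_natr mulrC ler_pdivrMr ?ltr0n// mul1r ler_nat.
by rewrite (leq_trans _ sM)// size_filter count_size.
Qed.

End harmonic_sums.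

Section separated_points.
Variable R : realType.
Implicit Types (s : seq nat) (y : nat -> R).

Definition separated (d : R) s y :=
  {in s &, forall k l, k != l -> d <= `|y k - y l|}.

(** Two points in the same cell [j d, (j + 1) d) are less than d apart. Counting and summing over
    separated points thus reduces to distinct integers. *)
Lemma separated_truncn (d : R) s y : 0 < d -> {in s, forall k, 0 <= y k} ->
  separated d s y -> {in s &, injective (fun k => Num.truncn (y k / d))}.
Proof.
move=> d0 y0 sep k l ks ls kl; apply/eqP/negPn/negP => /(sep _ _ ks ls).
have /truncn_itv := divr_ge0 (y0 _ ks) (ltW d0).
have /truncn_itv := divr_ge0 (y0 _ ls) (ltW d0).
rewrite kl !ler_pdivlMr// !ltr_pdivrMr// -natr1.
set t := (Num.truncn _)%:R; move=> /andP[h1 h2] /andP[h3 h4].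
by rewrite leNgt ltr_norml => /negP; apply; apply/andP; split; lra.
Qed.

Lemma count_separated (d c l : R) s y : 0 < d -> 0 <= l -> uniq s ->
  separated d s y ->
  (count (fun k => c <= y k <= c + l) s)%:R <= l / d + 1.
Proof.
move=> d0 l0 us sep.
rewrite -size_filter; set t := [seq _ <- _ | _].
have tP k : k \in t -> [/\ k \in s, 0 <= y k - c & y k - c <= l].
  by rewrite mem_filter => /andP[/andP[h1 h2] ->]; split => //; lra.
pose f k := Num.truncn ((y k - c) / d).
have uf : uniq (map f t).
  rewrite map_inj_in_uniq ?filter_uniq//.
  apply: separated_truncn => //.
    by move=> k /tP[].
  move=> k m /tP[ks _ _] /tP[ms _ _] km.
  by rewrite (_ : _ - _ = y k - y m); [exact: sep|ring].
have sub : {subset map f t <= iota 0 (Num.truncn (l / d)).+1}.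
  move=> _ /mapP[k /tP[_ h1 h2] ->]; rewrite mem_iota /= add0n ltnS.
  by apply: le_truncn; rewrite ler_pM2r ?invr_gt0.
have := uniq_leq_size uf sub; rewrite size_map size_iota => h.
have := truncn_itv (divr_ge0 l0 (ltW d0)) => /andP[h1 _].
rewrite (@le_trans _ _ (Num.truncn (l / d)).+1%:R) ?ler_nat//.
by rewrite -natr1 lerD2r.
Qed.

(** Each y k is at least d times its cell index, and the cell indices are distinct and positive, so
    [sum_inv_uniq_le] applies to them. *)
Lemma sum_inv_separated (d : R) s y (M : nat) : 0 < d -> uniq s ->
  (size s <= M)%N -> {in s, forall k, d <= y k} -> separated d s y ->
  \sum_(k <- s) (y k)^-1 <= d^-1 * (2 * ln M.+1%:R + 1).
Proof.
move=> d0 us sM yd sep.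
pose f k := Num.truncn (y k / d).
have y0 : {in s, forall k, 0 <= y k} by move=> k /yd; apply/le_trans/ltW.
have h : \sum_(j <- map f s) j%:R^-1 <= 2 * ln M.+1%:R + 1 :> R.
  apply: sum_inv_uniq_le.
  - by rewrite map_inj_in_uniq//; exact: separated_truncn.
  - by rewrite size_map.
  - by move=> _ /mapP[k ks ->]; rewrite truncn_gt0 ler_pdivlMr// mul1r yd.
rewrite (@le_trans _ _ (d^-1 * \sum_(j <- map f s) j%:R^-1))//; last first.
  by rewrite ler_pM2l ?invr_gt0.
rewrite big_map mulr_sumr big_seq [leRHS]big_seq; apply: ler_sum => k ks.
have f0 : (0 : R) < (f k)%:R by rewrite ltr0n truncn_gt0 ler_pdivlMr// mul1r yd.
rewrite -invfM lef_pV2 ?posrE ?mulr_gt0// ?(lt_le_trans d0 (yd _ ks))//.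
rewrite mulrC -ler_pdivlMr//.
by have /truncn_itv/andP[] := divr_ge0 (y0 _ ks) (ltW d0).
Qed.

(* The points at distance at least 1/(2q) from 0 are summed block by block; each
   block contains at most one other point. *)
Lemma sum_inv_blocks (q b N : nat) (E : R) y : (0 < q)%N -> 0 < E ->
  (N <= b * q)%N -> {in index_iota 0 N, forall k, (4 * E)^-1 <= y k} ->
  separated (2 * E)^-1 (index_iota 0 N) y ->
  (forall i, separated (2 * q%:R)^-1 [seq k <- index_iota 0 N | k %/ q == i] y)%N ->
  \sum_(0 <= k < N) (y k)^-1 <= 2 * q%:R * b%:R * (2 * ln q.+1%:R + 1)
    + 4 * E * (2 * ln b.+1%:R + 1).
Proof.
move=> q0 E0 Nb yE sepE sepq.
have qR0 : (0 : R) < q%:R by rewrite ltr0n.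
rewrite (bigID (fun k => (2 * q%:R)^-1 <= y k)) /= lerD//.
  case: b Nb => [|b] Nb.
    move: Nb; rewrite mul0n leqn0 => /eqP->.
    by rewrite big_geq// !(mulr0,mul0r).
  rewrite (partition_big (fun k => inord (k %/ q) : 'I_b.+1) predT)//=.
  have : \sum_(j < b.+1) \sum_(0 <= k < N | ((2 * q%:R)^-1 <= y k) &&
       (inord (k %/ q) == j :> 'I_b.+1)) (y k)^-1 <=
     \sum_(j < b.+1) 2 * q%:R * (2 * ln q.+1%:R + 1) :> R.
    apply: ler_sum => j _; rewrite -big_filter.
    set s := [seq _ <- _ | _].
    have sP k : k \in s -> [/\ k \in index_iota 0 N, (2 * q%:R)^-1 <= y k
        & (k %/ q)%N = j].
      rewrite mem_filter => /andP[/andP[h /eqP <-] kN]; split => //.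
      rewrite inordK// ltn_divLR//; apply: leq_trans Nb.
      by rewrite mem_index_iota in kN.
    have := @sum_inv_separated (2 * q%:R)^-1 s y q; rewrite invrK; apply.
    - by rewrite invr_gt0 mulr_gt0.
    - by rewrite filter_uniq// iota_uniq.
    - have <- : size (iota (j * q) q) = q by rewrite size_iota.
      apply: uniq_leq_size; first by rewrite filter_uniq// iota_uniq.
      move=> k /sP[_ _ kj]; rewrite mem_iota -kj.
      by rewrite leq_divM/= addnC -mulSn ltn_ceil.
    - by move=> k /sP[].
    - move=> k l /sP[ks _ kj] /sP[ls _ lj]; apply: (sepq j);
      by rewrite mem_filter ?kj ?lj eqxx.
  move/le_trans; apply.
  rewrite sumr_const card_ord -mulr_natr; lra.
rewrite -big_filter; set s := [seq _ <- _ | _].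
have sP k : k \in s -> [/\ k \in index_iota 0 N & y k < (2 * q%:R)^-1].
  by rewrite mem_filter -ltNge => /andP[].
have := @sum_inv_separated (4 * E)^-1 s y b; rewrite invrK; apply.
- by rewrite invr_gt0 mulr_gt0.
- by rewrite filter_uniq// iota_uniq.
- have <- : size [seq (k %/ q)%N | k <- s] = size s by rewrite size_map.
  have <- : size (iota 0 b) = b by rewrite size_iota.
  apply: uniq_leq_size.
    rewrite map_inj_in_uniq ?filter_uniq ?iota_uniq// => k l /sP[ks yk] /sP[ls yl] kl.
    apply/eqP/negPn/negP => /(sepq (k %/ q)%N k l).
    rewrite !mem_filter ks ls -kl eqxx => /(_ isT isT).
    rewrite leNgt ltr_norml => /negP; apply.
    have E4 : 0 < (4 * E)^-1 by rewrite invr_gt0 mulr_gt0.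
    by have := yE _ ks; have := yE _ ls => ? ?; apply/andP; split; lra.
  move=> _ /mapP[k /sP[ks _] ->]; rewrite mem_iota /= add0n ltn_divLR//.
  by apply: leq_trans Nb; rewrite mem_index_iota in ks.
- by move=> k /sP[ks _]; exact: yE.
- move=> k l /sP[ks _] /sP[ls _] kl; apply: le_trans (sepE k l ks ls kl).
  by rewrite lef_pV2 ?posrE ?mulr_gt0//; lra.
Qed.

End separated_points.

(** * Distribution of a block of an orbit *)

Section rational_block.
Variables (R : realType) (beta : R) (p : int) (q : nat).
Hypotheses (q0 : (0 < q)%N) (copq : coprimez p q%:Z)
  (betapq : `|q%:R * beta - p%:~R| <= q%:R^-1).

(** With m the integer part of q x, the point x + k beta is close to (m + k p) / q, and by
    coprimality the residues m + k p mod q are distinct for k < q. Replacing q x by m costs 1 / q,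
    and replacing q beta by p costs at most k / q^2 <= 1 / q. *)
Lemma rational_block (x : R) : exists2 s : 'I_q -> 'I_q, injective s &
  forall k : 'I_q, exists M : int, `|x + k%:R * beta - M%:~R - (s k)%:R / q%:R| <= 2 / q%:R.
Proof.
have qR0 : (0 : R) < q%:R by rewrite ltr0n.
have qz0 : q%:Z != 0 by rewrite eqz_nat -lt0n.
pose m : int := Num.floor (q%:R * x).
pose r (k : nat) : int := ((m + k%:Z * p) %% q%:Z)%Z.
have r0 k : 0 <= r k by rewrite modz_ge0.
have rq k : r k < q%:Z by rewrite ltz_pmod// ltz_nat.
have rE k : r k = `|r k|%N%:Z by rewrite gez0_abs.
have sP k : (`|r k| < q)%N by rewrite -ltz_nat -rE rq.
exists (fun k => Ordinal (sP k)) => [k l /(congr1 val)/= kl|k].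
  have : (q%:Z %| (k%:Z - l%:Z) * p)%Z.
    have : r k = r l by rewrite rE kl -rE.
    move/eqP; rewrite eqz_mod_dvd; congr (_ %| _)%Z; ring.
  rewrite Gauss_dvdzl; last by rewrite coprimez_sym.
  move=> /dvdzP[t tE]; apply/val_inj => /=.
  have := ltn_ord k; have := ltn_ord l => lq kq.
  suff t0 : t = 0 by rewrite t0 mul0r in tE; lia.
  by nia.
exists ((m + k%:Z * p) %/ q%:Z)%Z => /=.
have := divz_eq (m + k%:Z * p) q%:Z; rewrite -/(r k).
set M := (_ %/ _)%Z => mE.
have {}mE : (`|r k|%N%:R : R) = m%:~R + k%:R * p%:~R - M%:~R * q%:R.
  have -> : (`|r k|%N%:R : R) = (r k)%:~R by rewrite [in RHS]rE.
  have -> : r k = m + k%:Z * p - M * q%:Z by rewrite mE; ring.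
  by rewrite !(intrB,intrD,intrM) -!pmulrn.
pose e := q%:R * beta - p%:~R; have eq1 : `|e| <= q%:R^-1 by []; rewrite mE.
have -> : x + k%:R * beta - M%:~R - (m%:~R + k%:R * p%:~R - M%:~R * q%:R) / q%:R =
  ((q%:R * x - m%:~R) + k%:R * e) / q%:R.
  by rewrite /e; field; rewrite gt_eqF.
rewrite normrM [`|_^-1|]ger0_norm ?invr_ge0 ?ler0n// ler_pM2r ?invr_gt0//.
apply: (le_trans (ler_normD _ _)).
have h1 : `|q%:R * x - m%:~R| <= 1.
  have := floor_itv (q%:R * x); rewrite intrD -/m => /andP[? ?].
  by rewrite ger0_norm; lra.
have h2 : `|k%:R * e| <= 1.
  rewrite normrM ger0_norm ?ler0n//.
  have kq : (k%:R : R) <= q%:R by rewrite ler_nat ltnW.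
  rewrite (@le_trans _ _ (q%:R * q%:R^-1))//; last by rewrite mulfV ?gt_eqF.
  by apply: ler_pM.
lra.
Qed.

(** Orbit points attached to fractions j / q that are more than 2 / q inside the interval cannot
    leave it. On each side 2 indices are lost to this margin and at most 1 to rounding, which makes
    6. *)
Lemma count_block_ge (x a b : R) : 0 <= a -> b <= 1 ->
  (b - a) * q%:R - 6 <=
  (count (fun k => a < frac (x + k%:R * beta) < b) (index_iota 0 q))%:R.
Proof.
move=> a0 b1; have qR0 : (0 : R) < q%:R by rewrite ltr0n.
have [bq2|bq2] := ltP (b * q%:R) 2.
  have : 0 <= a * q%:R by rewrite mulr_ge0 ?ler0n.
  by move=> ?; apply: (@le_trans _ _ 0); rewrite ?ler0n//; lra.
have [s sinj sP] := rational_block x.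
rewrite -sum1_count big_mkord.
pose u := (Num.truncn (a * q%:R + 2)).+1; pose v := Num.truncn (b * q%:R - 2).
have uE : (u%:R : R) <= a * q%:R + 3 /\ a * q%:R + 2 < u%:R.
  have h : 0 <= a * q%:R + 2 by rewrite addr_ge0 ?mulr_ge0 ?ler0n.
  by have /andP[] := truncn_itv h; rewrite -/u -[u%:R]natr1 => *; split; lra.
have vE : (v%:R : R) <= b * q%:R - 2 /\ b * q%:R - 3 <= v%:R.
  have h : 0 <= b * q%:R - 2 by rewrite subr_ge0.
  by have /andP[] := truncn_itv h; rewrite -[_.+1%:R]natr1 -/v => *; split; lra.
have vq : (v <= q)%N.
  have : b * q%:R <= q%:R by rewrite ler_piMl ?ler0n.
  by rewrite -(ler_nat R); lra.
apply: (@le_trans _ _ (v - u)%N%:R).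
  have [uv|vu] := leqP u v; first by rewrite natrB//; lra.
  have /eqP -> : (v - u == 0)%N by rewrite subn_eq0 ltnW.
  have : (v%:R : R) <= u%:R by rewrite ler_nat ltnW.
  lra.
rewrite ler_nat.
have -> : (v - u = \sum_(i < q | (u <= i < v)) 1)%N.
  rewrite -(big_mkord (fun i => u <= i < v)%N (fun=> 1%N)).
  rewrite -big_filter_cond sum1_count -size_filter.
  rewrite -[LHS](size_iota u); apply/eqP; rewrite eqn_leq; apply/andP; split.
    apply: uniq_leq_size; first exact: iota_uniq.
    by move=> i; rewrite mem_iota !mem_filter mem_index_iota; lia.
  apply: uniq_leq_size; first by rewrite !filter_uniq// iota_uniq.
  by move=> i; rewrite mem_iota !mem_filter mem_index_iota; lia.
rewrite (reindex_inj sinj) /= [leqLHS]big_mkcond [leqRHS]big_mkcond /=.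
apply: leq_sum => k _; case: ifP => // /andP[uk kv].
case: ifP => // /negP; case.
have [M] := sP k; rewrite ler_norml => /andP[h1 h2].
set z := x + k%:R * beta - M%:~R - (s k)%:R / q%:R in h1 h2.
pose y := z + (s k)%:R / q%:R.
have uk' : (u%:R : R) <= (s k)%:R by rewrite ler_nat.
have kv' : ((s k)%:R : R) + 1 <= v%:R by rewrite natr1 ler_nat.
have ya : a < y.
  have : a < ((s k)%:R - 2) / q%:R by rewrite ltr_pdivlMr//; lra.
  by rewrite mulrBl /y; lra.
have yb : y < b.
  have : ((s k)%:R + 2) / q%:R < b by rewrite ltr_pdivrMr//; lra.
  by rewrite mulrDl /y; lra.
rewrite (@frac_eq _ _ y M) ?ya//; first by apply/andP; split; lra.
by rewrite /y /z; ring.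
Qed.

End rational_block.

(** * Lower bounds for Birkhoff sums of phi *)

Section phi_bounds.
Variable R : realType.
Implicit Types (x y z d : R).

Lemma phi_ge_inv y : 0 < y < 1 -> y^-1 <= phi y.
Proof. by move=> /andP[y0 y1]; rewrite lerDl invr_ge0; lra. Qed.

Lemma phi_ge_invB y : 0 < y < 1 -> (1 - y)^-1 <= phi y.
Proof. by move=> /andP[y0 y1]; rewrite lerDr invr_ge0; lra. Qed.

Lemma phi_gt0 y : 0 <= y < 1 -> 0 < phi y.
Proof.
move=> /andP[y0 y1]; rewrite /phi ltr_wpDl ?invr_ge0// invr_gt0; lra.
Qed.

(** According to the side of z on which M lies, the term 1 / y or the term 1 / (1 - y) of phi gives
    the bound. Positivity of the fractional part avoids the default value at 0. *)
Lemma phi_frac_ge z d (M : int) : 0 < frac z -> 0 < d -> `|z - M%:~R| <= d ->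
  d^-1 <= phi (frac z).
Proof.
move=> z0 d0; have /andP[_ z1] := frac_itv z.
rewrite ler_norml => /andP[h1 h2].
have [Mz|zM] := lerP M (Num.floor z).
  apply: (le_trans _ (phi_ge_inv _)); last by rewrite z0.
  rewrite lef_pV2 ?posrE// /frac.
  have : (M%:~R : R) <= (Num.floor z)%:~R by rewrite ler_int.
  lra.
apply: (le_trans _ (phi_ge_invB _)); last by rewrite z0.
rewrite lef_pV2 ?posrE// ?subr_gt0// /frac.
have : ((Num.floor z + 1)%:~R : R) <= M%:~R by rewrite ler_int; lia.
rewrite intrD; lra.
Qed.

Lemma phi_le y d : 0 < d -> d <= y -> d <= 1 - y -> phi y <= 2 / d.
Proof.
move=> d0 dy dy1.
have h1 : y^-1 <= d^-1 by rewrite lef_pV2 ?posrE//; lra.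
have h2 : (1 - y)^-1 <= d^-1 by rewrite lef_pV2 ?posrE//; lra.
rewrite /phi; lra.
Qed.

End phi_bounds.

Section sum_lower_bound.
Variables (R : realType) (alpha : R) (p : int) (q : nat).
Hypotheses (q0 : (0 < q)%N) (copq : coprimez p q%:Z)
  (alphapq : `|q%:R * alpha - p%:~R| <= q%:R^-1).

(** By [rational_block] the points of a block are within (j + 2) / q of an integer, where j takes
    every value below q once; this gives q times a harmonic sum. *)
Lemma sum_phi_block_ge (x : R) :
  (forall k, 0 < frac (x + k%:R * alpha)) ->
  q%:R * (ln q%:R / 2) <= \sum_(0 <= k < q) phi (frac (x + k%:R * alpha)).
Proof.
move=> x0; have qR0 : (0 : R) < q%:R by rewrite ltr0n.
have [s sinj sP] := rational_block q0 copq alphapq x.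
apply: (@le_trans _ _ (\sum_(0 <= j < q) q%:R * j.+2%:R^-1)).
  rewrite -mulr_sumr ler_pM2l//.
  apply: (@le_trans _ _ (\sum_(1 <= j < q.+1) j.+1%:R^-1)); last first.
    by rewrite big_add1.
  apply: (le_trans _ (ln_ge_harmonic _ _)) => //.
  (* This is q <= ((q + 2) / 2)^2; it is the source of the factor 1 / 2. *)
  have h : 2 * (ln q.+2%:R - ln 2) >= ln q%:R :> R.
    rewrite -ln_div ?posrE// -[2 * _]mulrC mulr_natr -lnXn ?divr_gt0//.
    rewrite ler_ln ?posrE ?exprn_gt0 ?divr_gt0// expr_div_n ler_pdivlMr//.
    by rewrite -2!natr1; nra.
  by lra.
rewrite [leLHS]big_mkord (reindex_inj sinj) big_mkord /=.
apply: ler_sum => k _; have [M] := sP k.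
set j : nat := s k; move=> h.
have -> : q%:R * j.+2%:R^-1 = (j.+2%:R / q%:R)^-1 :> R by rewrite invfM invrK mulrC.
apply: (phi_frac_ge (M := M)) => //; first by rewrite divr_gt0.
rewrite (_ : x + k%:R * alpha - M%:~R =
  (x + k%:R * alpha - M%:~R - j%:R / q%:R) + j%:R / q%:R); last by ring.
apply: (le_trans (ler_normD _ _)).
rewrite [X in _ + X]ger0_norm ?divr_ge0// (_ : j.+2%:R = 2 + j%:R :> R).
  by rewrite mulrDl lerD2r.
by rewrite -natrD.
Qed.

Lemma sum_phi_blocks_ge (x : R) (b : nat) :
  (forall k, 0 < frac (x + k%:R * alpha)) ->
  (b * q)%:R * (ln q%:R / 2) <=
  \sum_(0 <= k < b * q) phi (frac (x + k%:R * alpha)).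
Proof.
move=> x0; elim: b => [|b IH]; first by rewrite mul0n big_geq// mul0r.
rewrite (big_cat_nat _ _ (n := (b * q)%N)) ?leq_mul//=.
rewrite mulSnr natrD mulrDl lerD//.
rewrite -{1}[(b * q)%N]add0n big_addn addKn.
have e k : x + (k + b * q)%N%:R * alpha = x + (b * q)%:R * alpha + k%:R * alpha.
  by rewrite natrD; ring.
under eq_bigr do rewrite e.
by apply: sum_phi_block_ge => k; rewrite -e.
Qed.

Lemma sum_phi_ge (x : R) (N : nat) : (q <= N)%N ->
  (forall k, 0 < frac (x + k%:R * alpha)) ->
  N%:R * ln q%:R / 4 <= \sum_(0 <= k < N) phi (frac (x + k%:R * alpha)).
Proof.
move=> qN x0.
rewrite (big_cat_nat _ _ (n := (N %/ q * q)%N)) ?leq_divM//=.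
(* The complete blocks cover at least half of the times because N >= q. *)
apply: (@le_trans _ _ ((N %/ q * q)%:R * (ln q%:R / 2))).
  have ln0 : 0 <= ln q%:R :> R by rewrite ln_ge0// ler1n.
  have : N%:R <= 2 * (N %/ q * q)%:R :> R.
    rewrite -natrM ler_nat; have := divn_eq N q; have := ltn_pmod N q0.
    have : (0 < N %/ q)%N by rewrite divn_gt0.
    by nia.
  by nra.
rewrite -[leLHS]addr0 lerD ?sum_phi_blocks_ge// sumr_ge0// => k _.
by rewrite ltW// phi_gt0// frac_itv.
Qed.

End sum_lower_bound.

(** * The convergent half *)

Section summation_lemmas.
Variable R : realType.

Lemma ler_sum_sub (s t : seq nat) (F : nat -> R) : uniq s -> uniq t ->
  {subset s <= t} -> (forall k, 0 <= F k) ->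
  \sum_(k <- s) F k <= \sum_(k <- t) F k.
Proof.
move=> us ut st F0; rewrite [leRHS](bigID (mem s)) /= -[X in _ <= X + _]big_filter.
set u := [seq _ <- _ | _]; have us_perm : perm_eq u s.
  apply: uniq_perm => //; first by rewrite filter_uniq.
  by move=> k; rewrite mem_filter; apply: andb_idr => /st.
by rewrite (perm_big _ us_perm) lerDl sumr_ge0.
Qed.

Lemma sum_if_lt_le (m n : nat) (t C : R) : 0 <= t -> 0 <= C ->
  \sum_(m <= N < n) (if N%:R < t then C else 0) <= C * (t + 1).
Proof.
move=> t0 C0; rewrite -big_mkcond -big_filter big_const_seq count_predT iter_addr_0.
rewrite -mulr_natr ler_wpM2l//.
have /truncn_itv/andP[h1 _] := t0.
apply: (@le_trans _ _ (Num.truncn t).+1%:R); last by rewrite -natr1 lerD2r.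
rewrite ler_nat -(size_iota 0 (Num.truncn t).+1).
apply: uniq_leq_size; first by rewrite filter_uniq// iota_uniq.
move=> k; rewrite mem_filter mem_iota /= add0n => /andP[kt _].
by rewrite ltnS truncn_ge_nat// ltW.
Qed.

(** Comparison with the telescoping sum of ln (max j t), whose increments are nonnegative below t
    and control 1 / j from t on. *)
Lemma sum_if_ge_le (m n : nat) (t : R) : (0 < m <= n)%N -> 0 < t ->
  \sum_(m <= N < n) (if t <= N%:R then N%:R^-1 else 0) <=
  2 * (ln (Num.max n%:R t) - ln t).
Proof.
move=> /andP[m0 mn] t0.
apply: (@le_trans _ _ (2 * (ln (Num.max n%:R t) - ln (Num.max m%:R t)))); last first.
  rewrite ler_pM2l// lerD2l lerN2 ler_ln ?posrE ?lt_max ?t0 ?orbT//.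
  by rewrite le_max lexx orbT.
rewrite -(telescope_sumr (fun j => ln (Num.max j%:R t)))// mulr_sumr.
apply: ler_sum_nat => j /andP[mj _].
have j0 : (0 : R) < j%:R by rewrite ltr0n (leq_trans m0).
case: ifPn => tj.
  have := @harmonic_le_ln R j j.+1; rewrite big_nat1 !max_l//.
    by apply; rewrite (leq_trans m0)//=.
  by rewrite (le_trans tj)// ler_nat.
rewrite mulr_ge0// subr_ge0 ler_ln ?posrE ?lt_max ?t0 ?orbT//.
by rewrite ge_max !le_max lexx orbT andbT ler_nat leqnSn.
Qed.

(** The returns N - j q with 1 <= j <= b contribute at least q' times this sum when x + N alpha is
    within 1 / q' of 0: the j-th one is then within (j + 1) / q' of 0. *)
Definition shifted_harmonic (b : nat) : R := \sum_(1 <= j < b.+1) j.+1%:R^-1.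

Lemma shifted_harmonic_ge_ln b : ln b.+2%:R - ln 2 <= shifted_harmonic b.
Proof. exact: ln_ge_harmonic. Qed.

Lemma shifted_harmonic_ge_half b : (0 < b)%N -> 2^-1 <= shifted_harmonic b.
Proof.
move=> b0; rewrite /shifted_harmonic big_ltn ?ltnS//.
by rewrite lerDl sumr_ge0// => j _; rewrite invr_ge0.
Qed.

Lemma ln2_bounds : 2^-1 <= ln (2 : R) <= 1.
Proof.
apply/andP; split; last by have := @le_ln1Dx R 1; rewrite -[1 + 1]/2; apply; lra.
have := @le_ln1Dx R (- 2^-1); rewrite (_ : 1 - 2^-1 = 2^-1); last by field.
by rewrite lnV ?posrE// => h; have := h ltac:(lra); lra.
Qed.

Lemma shifted_harmonic_large (c : R) : exists2 B, (0 < B)%N &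
  forall b, (B <= b)%N -> c <= shifted_harmonic b.
Proof.
exists (Num.truncn (expR (c + 1))).+1 => // b Bb.
apply: le_trans (shifted_harmonic_ge_ln b).
have : c + 1 <= ln b.+2%:R.
  rewrite -[c + 1]expRK ler_ln ?posrE ?expR_gt0 ?ltr0Sn//.
  apply: (le_trans (ltW (truncnS_gt _))).
  by rewrite ler_nat (leq_trans Bb)//; exact: leq_trans (leqnSn _) (leqnSn _).
by have /andP[_ ?] := ln2_bounds; lra.

Qed.

(* The two radii come from the lower bounds N ln q / 4 and q' H of the Birkhoff
   sum at time N; the second one is available once H is large. *)
Definition near_radius (c : R) (q q' N : nat) : R :=
  let H := shifted_harmonic (N %/ q) in
  let rho := 8 / (c * N%:R * ln q%:R) in
  if 4 / c <= H then Num.min rho (2 / (c * H * q'%:R)) else rho.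

Lemma near_radius_ge0 c q q' N : 0 < c -> 0 <= near_radius c q q' N.
Proof.
move=> c0; have ln0 : 0 <= ln q%:R :> R.
  by case: q => [|q]; [rewrite ln0|rewrite ln_ge0// ler1n].
have r0 : 0 <= 8 / (c * N%:R * ln q%:R) by rewrite divr_ge0// !mulr_ge0// ltW.

rewrite /near_radius; case: ifP => // h; rewrite le_min r0 divr_ge0//.
have H0 : 0 <= shifted_harmonic (N %/ q) by rewrite (le_trans _ h)// divr_ge0// ltW.
by rewrite !mulr_ge0// ltW.
Qed.

(* [W alpha n] is [level_weight (q n) (q n.+1)]. *)
Definition level_weight (q q' : nat) : R :=
  if q'%:R < 2 * q%:R * ln q%:R :> R then (ln q'%:R - ln q%:R) / ln q%:R
  else Num.max 1 (ln (ln q%:R) - ln (ln (q'%:R / (q%:R * ln q%:R)))) / ln q%:R.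

(** Merges the two available lower bounds of H into a multiple of l = ln P, whatever the size of
    P. *)
Lemma eighth_le (l H : R) : 2^-1 <= H -> l / 2 - 1 <= H -> l / 8 <= H.
Proof. by move=> h1 h2; have [|] := lerP l 4; lra. Qed.

(** If q' < 2 q ln q, the first radius alone sums to a multiple of ln (q' / q) / ln q. Otherwise put
    P = q' / (q ln q): the two radii are comparable near N = t = q P ln P. The times below t
    contribute O(1 / ln q), and the first radius summed over t <= N < q' gives a multiple of ln (q'
    / t) / ln q, where q' / t = ln q / ln P. *)
Lemma near_radius_sum (c : R) : 0 < c -> exists2 A, 0 <= A &
  forall q q', (1 < q <= q')%N -> 1 <= ln q%:R :> R ->
  \sum_(q <= N < q') near_radius c q q' N <= A * level_weight q q'.
Proof.
move=> c0; have [B0 B00 HB0] := shifted_harmonic_large (4 / c).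
(* The numerator adds up the constants 8 B0 + 8, 8, 32 and 16 of the four ranges of N; it also
   exceeds the 16 of the case q' < 2 q ln q. *)
exists ((8 * B0%:R + 64) / c) => [|q q' /andP[q1 qq'] L1].
  by rewrite divr_ge0 ?addr_ge0 ?mulr_ge0// ltW.
set L := ln q%:R in L1 *.
have q0 : (0 < q)%N by exact: ltnW.
have qR1 : (1 : R) <= q%:R by rewrite ler1n.
have qR0 : (0 : R) < q%:R by lra.
have q'R : (q%:R : R) <= q'%:R by rewrite ler_nat.
have L0 : 0 < L by lra.
have B0R : (1 : R) <= B0%:R by rewrite ler1n.
have near1 N : near_radius c q q' N <= 8 / (c * L) * N%:R^-1.
  have -> : 8 / (c * L) * N%:R^-1 = 8 / (c * N%:R * ln q%:R).
    by rewrite -/L -mulrA -invfM (mulrAC c).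
  by rewrite /near_radius; case: ifP => // _; rewrite ge_min lexx.
rewrite /level_weight -/L; case: ifPn => [q'lt|].
  apply: (@le_trans _ _ (\sum_(q <= N < q') 8 / (c * L) * N%:R^-1)).
    by apply: ler_sum.
  rewrite -mulr_sumr.
  apply: (@le_trans _ _ (8 / (c * L) * (2 * (ln q'%:R - L)))).
    by rewrite ler_pM2l ?divr_gt0 ?mulr_gt0// harmonic_le_ln ?q0.
  have -> : 8 / (c * L) * (2 * (ln q'%:R - L)) = 16 / c * ((ln q'%:R - L) / L).
    by field; rewrite !gt_eqF.
  rewrite ler_wpM2r// ?divr_ge0 ?(ltW L0)//.
    by rewrite subr_ge0 ler_ln ?posrE// (lt_le_trans qR0).
  by rewrite ler_pM2r ?invr_gt0//; lra.
rewrite -leNgt => q'ge; set P := q'%:R / (q%:R * L).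
have qL0 : 0 < q%:R * L by rewrite mulr_gt0.
have P2 : 2 <= P by rewrite /P ler_pdivlMr//; lra.
have P0 : 0 < P by lra.
have q'E : q'%:R = P * q%:R * L by rewrite /P; field; rewrite !gt_eqF.
have q'0 : 0 < q'%:R :> R by rewrite (lt_le_trans qR0).
clearbody P.
have ln2P : ln 2 <= ln P by rewrite ler_ln ?posrE.
have /andP[ln2 ln21] := ln2_bounds.
have lnP0 : 0 < ln P by lra.
set W := Num.max _ _ / L.
have W1 : L^-1 <= W by rewrite /W -[leLHS]mul1r ler_pM2r ?invr_gt0// le_max lexx.
have W2 : (ln L - ln (ln P)) / L <= W.
  by rewrite /W ler_pM2r ?invr_gt0// le_max lexx orbT.
have W0 : 0 < W by rewrite (lt_le_trans _ W1)// invr_gt0.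
pose s := expR (ln P / 2).
have s0 : 0 < s by exact: expR_gt0.
have ss : s * s = P by rewrite -expRD -splitr lnK.
have s1 : 1 <= s by nra.
have sP : s <= P by nra.
pose t := q%:R * P * ln P.
have t0 : 0 < t by rewrite /t mulr_gt0// mulr_gt0.
(* N < B0 q: use rho only; N < q sqrt(P): H >= 1/2; N < q P ln P: H >= ln P / 8;
   beyond: rho again. *)
pose f1 N : R := if N%:R < B0%:R * q%:R :> R then 8 / (c * q%:R * L) else 0.
pose f2 N : R := if N%:R < q%:R * s :> R then 4 / (c * q'%:R) else 0.
pose f3 N : R := if N%:R < t then 16 / (c * q'%:R * ln P) else 0.
pose f4 N : R := if t <= N%:R then N%:R^-1 else 0.
have f10 N : 0 <= f1 N.
  by rewrite /f1; case: ifP => // _; rewrite divr_ge0// !mulr_ge0// ltW.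
have f20 N : 0 <= f2 N.
  by rewrite /f2; case: ifP => // _; rewrite divr_ge0// !mulr_ge0// ltW.
have f30 N : 0 <= f3 N.
  by rewrite /f3; case: ifP => // _; rewrite divr_ge0// !mulr_ge0// ltW.
have f40 N : 0 <= f4 N by rewrite /f4; case: ifP.
have cL0 : 0 <= 8 / (c * L) by rewrite divr_ge0// mulr_ge0// ltW.
have ptw N : (q <= N)%N ->
    near_radius c q q' N <= f1 N + f2 N + f3 N + 8 / (c * L) * f4 N.
  move=> qN; have qNR : (q%:R : R) <= N%:R by rewrite ler_nat.
  have N0 : (0 : R) < N%:R by lra.
  have f40' : 0 <= 8 / (c * L) * f4 N by rewrite mulr_ge0.
  have := near1 N.
  have [tN|Nt] := leP t N%:R.
    have -> : N%:R^-1 = f4 N by rewrite /f4 tN.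
    by have := f10 N; have := f20 N; have := f30 N; lra.
  have f3E : f3 N = 16 / (c * q'%:R * ln P) by rewrite /f3 Nt.
  have [NB|BN] := ltP (N%:R : R) (B0%:R * q%:R).
    have f1E : f1 N = 8 / (c * q%:R * L) by rewrite /f1 NB.
    have : 8 / (c * L) * N%:R^-1 <= f1 N.
      rewrite f1E -mulrA -invfM ler_pM2l// lef_pV2 ?posrE ?mulr_gt0//.
      by rewrite -(mulrA c L) -(mulrA c) ler_pM2l// mulrC ler_pM2l.
    by have := f20 N; have := f30 N; lra.
  move=> _; have bB : (B0 <= N %/ q)%N.
    by rewrite leq_divRL// -(ler_nat R) natrM.
  have Hc := HB0 _ bB.
  have b0 : (0 < N %/ q)%N by apply: leq_trans bB.
  have Hh := shifted_harmonic_ge_half b0.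
  set H := shifted_harmonic _ in Hc Hh.
  have H0 : 0 < H by lra.
  have nearH : near_radius c q q' N <= 2 / (c * H * q'%:R).
    by rewrite /near_radius -/H Hc ge_min lexx orbT.
  have [Ns|sN] := ltP (N%:R : R) (q%:R * s).
    have f2E : f2 N = 4 / (c * q'%:R) by rewrite /f2 Ns.
    have : 2 / (c * H * q'%:R) <= f2 N.
      rewrite f2E ler_pdivrMr ?mulr_gt0//.
      have -> : 4 / (c * q'%:R) * (c * H * q'%:R) = 4 * H.
        by field; rewrite !gt_eqF.
      lra.
    by have := f10 N; have := f30 N; lra.
  have HP : ln P / 8 <= H.
    have Hl := shifted_harmonic_ge_ln (N %/ q); rewrite -/H in Hl.
    have : ln P / 2 <= ln (N %/ q).+2%:R.
      rewrite -[ln P / 2]expRK ler_ln ?posrE ?expR_gt0 ?ltr0Sn//.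
      rewrite -/s (@le_trans _ _ (N%:R / q%:R))//.
        by rewrite ler_pdivlMr// mulrC.
      rewrite ler_pdivrMr// -natrM ler_nat.
      by rewrite (leq_trans (ltnW (ltn_ceil N q0)))// leq_mul2r leqnSn orbT.
    move=> lnb; apply: eighth_le => //; apply: le_trans Hl.
    by rewrite lerB.
  have : 2 / (c * H * q'%:R) <= f3 N.
    rewrite f3E ler_pdivrMr ?mulr_gt0//.
    have -> : 16 / (c * q'%:R * ln P) * (c * H * q'%:R) = 16 * H / ln P.
      by field; rewrite !gt_eqF.
    by rewrite ler_pdivlMr//; lra.
  by have := f10 N; have := f20 N; lra.
apply: (@le_trans _ _ (\sum_(q <= N < q')
    (f1 N + f2 N + f3 N + 8 / (c * L) * f4 N))).
  by apply: ler_sum_nat => N /andP[qN _]; exact: ptw.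
rewrite !big_split /= -mulr_sumr.
have c'0 : 0 < c^-1 by rewrite invr_gt0.
have L'0 : 0 < L^-1 by rewrite invr_gt0.
have L'1 : L^-1 <= 1 by rewrite invf_le1.
have s1E : \sum_(q <= N < q') f1 N <= (8 * B0%:R + 8) / c * W.
  apply: (@le_trans _ _ (8 / (c * q%:R * L) * (B0%:R * q%:R + 1))).
    by apply: sum_if_lt_le; rewrite ?divr_ge0 ?mulr_ge0// ltW.
  have -> : 8 / (c * q%:R * L) * (B0%:R * q%:R + 1) =
    c^-1 * L^-1 * (8 * B0%:R + 8 * q%:R^-1) by field; rewrite !gt_eqF.
  have q'1 : q%:R^-1 <= 1 :> R by rewrite invf_le1.
  apply: (@le_trans _ _ (c^-1 * L^-1 * (8 * B0%:R + 8))).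
    by rewrite ler_pM2l ?mulr_gt0//; lra.
  rewrite -mulrA (mulrC L^-1) mulrA (mulrC c^-1).
  by rewrite ler_pM2l// mulr_gt0//; lra.
have s2E : \sum_(q <= N < q') f2 N <= 8 / c * W.
  apply: (@le_trans _ _ (4 / (c * q'%:R) * (q%:R * s + 1))).
    by apply: sum_if_lt_le; rewrite ?divr_ge0 ?mulr_ge0// ltW.
  apply: (@le_trans _ _ (8 / c * L^-1)); last by rewrite ler_pM2l// divr_gt0.
  rewrite -[4 / _ * _]mulrAC ler_pdivrMr ?mulr_gt0//.
  have -> : 8 / c * L^-1 * (c * q'%:R) = 8 * P * q%:R.
    by rewrite q'E; field; rewrite !gt_eqF.
  nra.
have s3E : \sum_(q <= N < q') f3 N <= 32 / c * W.
  apply: (@le_trans _ _ (16 / (c * q'%:R * ln P) * (t + 1))).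
    by apply: sum_if_lt_le; rewrite ?divr_ge0 ?mulr_ge0// ltW.
  apply: (@le_trans _ _ (32 / c * L^-1)); last by rewrite ler_pM2l// divr_gt0.
  rewrite -[16 / _ * _]mulrAC ler_pdivrMr ?mulr_gt0//.
  have -> : 32 / c * L^-1 * (c * q'%:R * ln P) = 32 * t.
    by rewrite q'E /t; field; rewrite !gt_eqF.
  suff : 1 <= t by lra.
  rewrite /t; have : 1 <= P * ln P by nra.
  by rewrite -mulrA; nra.
have s4E : 8 / (c * L) * \sum_(q <= N < q') f4 N <= 16 / c * W.
  apply: (@le_trans _ _ (8 / (c * L) * (2 * (ln (Num.max q'%:R t) - ln t)))).
    by rewrite ler_wpM2l//; apply: sum_if_ge_le; rewrite ?q0.
  have -> : 8 / (c * L) * (2 * (ln (Num.max q'%:R t) - ln t)) =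
     16 / c * ((ln (Num.max q'%:R t) - ln t) / L) by field; rewrite !gt_eqF.
  rewrite ler_pM2l ?divr_gt0//.
  (* For t > q' the last range is empty; for t <= q' its logarithm is the second entry of the
     maximum in W. *)
  have [tq|qt] := leP t q'%:R; last by rewrite subrr mul0r ltW.
  rewrite -ln_div ?posrE//.
  have -> : q'%:R / t = L / ln P by rewrite q'E /t; field; rewrite !gt_eqF.
  by rewrite ln_div ?posrE.
have -> : (8 * B0%:R + 64) / c * W = (8 * B0%:R + 8) / c * W + 8 / c * W +
    32 / c * W + 16 / c * W by ring.
by rewrite !lerD.
Qed.

Lemma level_weight_ge0 q q' : (1 < q <= q')%N -> 0 <= level_weight q q'.
Proof.
move=> /andP[q1 qq'].
have L0 : 0 < ln q%:R :> R by rewrite ln_gt0// ltr1n.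
rewrite /level_weight; case: ifP => _; apply: divr_ge0; rewrite ?(ltW L0)//.
  have q0 : (0 < q)%N by exact: ltnW.
  by rewrite subr_ge0 ler_ln ?posrE ?ltr0n ?ler_nat// (leq_trans q0).
by rewrite le_max ler01.
Qed.

End summation_lemmas.

Section limsup_criteria.
Variable R : realType.

Lemma limn_esup_eq0 (u : nat -> R) : (forall n, 0 <= u n) ->
  (forall c, 0 < c -> exists m, forall n, (m <= n)%N -> u n <= c) ->
  limn_esup (fun n => (u n)%:E) = 0%:E.
Proof.
move=> u0 ule; apply: (cvg_limn_einf_sup _).2; apply: cvg_EFin.
  by apply: nearW => n.
apply/cvgr0Pnorm_le => c c0; have [m um] := ule c c0.
exists m => // n /= mn; rewrite ger0_norm ?u0//; exact: um.
Qed.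

Lemma limn_esup_eqy (u : nat -> R) :
  (forall C m, exists2 n, (m <= n)%N & C <= u n) ->
  limn_esup (fun n => (u n)%:E) = +oo%E.
Proof.
move=> uge; rewrite limn_esup_lim.
rewrite (_ : esups _ = fun=> +oo%E); first by apply: cvg_lim => //; exact: cvg_cst.
apply/funext => m; apply/eq_infty => C; have [n mn Cu] := uge C m.
apply: le_trans (_ : (u n)%:E <= _)%E; first by rewrite lee_fin.
by apply: ereal_sup_ubound; exists n.
Qed.

End limsup_criteria.

(** * Near returns and the Borel-Cantelli argument *)

Section near_sets.
Variables (R : realType) (alpha : R).
Local Notation mu := (@lebesgue_measure R).

(** A cover in the real line of the arc of radius rho around - N alpha; the two translates catch the
    parts that wrap around the ends of [0, 1). *)
Definition near_set (N : nat) (rho : R) : set R :=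
  let f := frac (- (N%:R * alpha)) in
  `[f - rho, f + rho] `|` (`[f - 1 - rho, f - 1 + rho] `|` `[f + 1 - rho, f + 1 + rho]).

Lemma measurable_near_set N rho : measurable (near_set N rho).
Proof. by apply: measurableU => //; apply: measurableU. Qed.

Lemma mu_near_set N rho : 0 <= rho -> (mu (near_set N rho) <= (6 * rho)%:E)%E.
Proof.
move=> rho0.
have itvE (c : R) : (mu `[(c - rho)%R, (c + rho)%R]%classic <= (2 * rho)%:E)%E.
  rewrite lebesgue_measure_itv /=; case: ifP => _; last by rewrite lee_fin mulr_ge0.
  by rewrite -EFinB lee_fin; lra.
have -> : (6 * rho)%:E = ((2 * rho)%:E + ((2 * rho)%:E + (2 * rho)%:E))%E.
  by rewrite -!EFinD; congr EFin; ring.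
rewrite /near_set; apply: (le_trans (measureU2 mu _ _)) => //.
  exact: measurableU.
apply: leeD; first exact: itvE.
apply: (le_trans (measureU2 mu _ _)) => //.
by apply: leeD; exact: itvE.
Qed.

Lemma near_setP x N rho (M : int) : 0 <= x < 1 ->
  `|x + N%:R * alpha - M%:~R| <= rho -> near_set N rho x.
Proof.
move=> /andP[x0 x1]; rewrite /near_set.
have := frac_itv (- (N%:R * alpha)).
set f := frac _ => /andP[f0 f1].
pose F := Num.floor (- (N%:R * alpha)).
have -> : x + N%:R * alpha - M%:~R = x - f - (F + M)%:~R.
  by rewrite /f /frac -/F intrD; ring.
set m := F + M => h.
(* For rho >= 1 the central interval contains [0, 1); for smaller rho only the translates by -1, 0
   and 1 can occur. *)
have [rho1|rho1] := lerP 1 rho.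
  by left; rewrite /= in_itv /=; apply/andP; split; lra.
have : `|m| < 2.
  have : `|m%:~R| < (2%:~R : R).
    have : `|m%:~R| <= `|x - f| + rho.
      rewrite (_ : m%:~R = (x - f) - (x - f - m%:~R)); last by ring.
      by rewrite (le_trans (ler_normB _ _))// lerD2l.
    have : `|x - f| < 1 by rewrite ltr_norml; apply/andP; split; lra.
    by move=> ? ?; rewrite -[2%:~R]/(2 : R); lra.
  by rewrite -intr_norm ltr_int.
move: h; rewrite ler_norml => /andP[].
move=> h1 h2 m2.
have [m0|[m0|m0]] : m = 0 \/ m = 1 \/ m = -1 by lia.
- by left; rewrite /= in_itv /= ; rewrite m0 in h1 h2; apply/andP; split; lra.
- by right; right; rewrite /= in_itv /= ; rewrite m0 in h1 h2; apply/andP; split; lra.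
- right; left; rewrite /= in_itv /=.
  by move: h1 h2; rewrite m0 intrN => h1 h2; apply/andP; split; lra.
Qed.

End near_sets.

Section return_distance.
Variables (R : realType) (alpha : R) (p : int) (q q' : nat).
Hypotheses (q0 : (0 < q)%N) (q'0 : (0 < q')%N) (copq : coprimez p q%:Z)
  (alphapq : `|q%:R * alpha - p%:~R| <= q%:R^-1)
  (alphapq' : `|q%:R * alpha - p%:~R| <= q'%:R^-1).

(** If d is the distance from x + N alpha to the nearest integer, then c S_N <= phi <= 2 / d, so
    every lower bound of S_N bounds d from above. One comes from the complete blocks, the other from
    the returns N - j q, which are within d + j / q' of an integer. *)
Lemma near_return (x c : R) N : 0 < c -> 1 <= ln q%:R :> R -> (q <= N)%N ->
  (forall k, 0 < frac (x + k%:R * alpha)) ->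
  c * \sum_(0 <= k < N) phi (frac (x + k%:R * alpha)) <=
    phi (frac (x + N%:R * alpha)) ->
  exists M : int, `|x + N%:R * alpha - M%:~R| <= near_radius c q q' N.
Proof.
move=> c0 L1 qN x0 cS.
set S := \sum_(_ <= _ < _) _ in cS; set y := frac (x + N%:R * alpha) in cS.
have y0 : 0 < y by exact: x0.
have /andP[_ y1] := frac_itv (x + N%:R * alpha); rewrite -/y in y1.
(* M is the nearest integer, to the left or to the right depending on the half of [0, 1) in which y
   lies. *)
have [M [d [d0 Md dy dy1]]] : exists (M : int) (d : R),
    [/\ 0 < d, `|x + N%:R * alpha - M%:~R| = d, d <= y & d <= 1 - y].
  have zE : x + N%:R * alpha = y + (Num.floor (x + N%:R * alpha))%:~R.
    by rewrite /y /frac subrK.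
  have [y2|y2] := lerP y (1 / 2).
    exists (Num.floor (x + N%:R * alpha)), y; split; try lra.
    by rewrite {1}zE addrK gtr0_norm.
  exists (Num.floor (x + N%:R * alpha) + 1), (1 - y); split; try lra.
  by rewrite {1}zE intrD opprD addrA addrK -normrN opprB gtr0_norm ?subr_gt0.
exists M; rewrite Md.
have phid : phi y <= 2 / d by exact: phi_le.
have N0 : (0 : R) < N%:R by rewrite ltr0n (leq_trans q0).
have h1 : d <= 8 / (c * N%:R * ln q%:R).
  have := sum_phi_ge q0 copq alphapq qN x0; rewrite -/S => Sge.
  have : c * (N%:R * ln q%:R / 4) <= 2 / d.
    by apply: le_trans phid; apply: le_trans cS; rewrite ler_pM2l.
  rewrite ler_pdivlMr// ler_pdivlMr ?mulr_gt0//; last by lra.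
  by move=> ?; lra.
rewrite /near_radius; case: ifP => // Hc; rewrite le_min h1 /=.
set b := (N %/ q)%N in Hc *; set H := shifted_harmonic R b in Hc *.
have H0 : 0 < H by rewrite (lt_le_trans _ Hc)// divr_gt0.
have q'R0 : (0 : R) < q'%:R by rewrite ltr0n.
have bN : (b * q <= N)%N by exact: leq_divM.
have Sge : \sum_(1 <= j < b.+1) (d + j%:R / q'%:R)^-1 <= S.
  pose F k := phi (frac (x + k%:R * alpha)).
  apply: (@le_trans _ _ (\sum_(1 <= j < b.+1) F (N - j * q)%N)).
    apply: ler_sum_nat => j /andP[j0 jb].
    have jN : (j * q <= N)%N by rewrite (leq_trans _ bN)// leq_mul.
    have dj0 : 0 < d + j%:R / q'%:R.
      have j0R : (0 : R) < j%:R by rewrite ltr0n.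
      by rewrite addr_gt0// divr_gt0.
    rewrite /F; set z := x + (N - j * q)%N%:R * alpha.
    have z0 : 0 < frac z by exact: x0.
    apply: (@phi_frac_ge R z _ (M - j%:Z * p) z0 dj0); rewrite {z0}/z.
    rewrite natrB// natrM.
    rewrite (_ : _ - _ = (x + N%:R * alpha - M%:~R) -
        j%:R * (q%:R * alpha - p%:~R)); last first.
      by rewrite intrB intrM -!pmulrn; ring.
    apply: (le_trans (ler_normB _ _)); rewrite Md lerD2l normrM ger0_norm//.
    by rewrite ler_wpM2l.
  rewrite -(big_map (fun j => N - j * q)%N predT F).
  apply: ler_sum_sub => [||_ /mapP[j + ->]|k].
  - rewrite map_inj_in_uniq ?iota_uniq// => i j.
    rewrite !mem_index_iota => /andP[_ ib] /andP[_ jb] ij.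
    have iN : (i * q <= N)%N by rewrite (leq_trans _ bN)// leq_mul.
    have jN : (j * q <= N)%N by rewrite (leq_trans _ bN)// leq_mul.
    have := congr1 (subn N) ij; rewrite /= !subKn// => /eqP.
    by rewrite eqn_pmul2r// => /eqP.
  - exact: iota_uniq.
  - rewrite !mem_index_iota /= => /andP[j0 _].
    by rewrite ltn_subrL muln_gt0 j0 q0 (leq_trans q0 qN).
  - by rewrite ltW// phi_gt0// frac_itv.
have cS2 : c * S <= 2 / d by exact: le_trans phid.
(* If d >= 1 / q', then d + j / q' <= (j + 1) d and S >= H / d, which contradicts c S <= 2 / d
   because c H >= 4; hence the threshold in [near_radius]. *)
have [d1|d1] := lerP q'%:R^-1 d.
  exfalso.
  have dj0 j : 0 < d + j%:R / q'%:R by rewrite ltr_pwDl// divr_ge0.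
  have : H / d <= S.
    apply: le_trans Sge; rewrite mulr_suml; apply: ler_sum_nat => j _.
    rewrite -invfM lef_pV2 ?posrE ?dj0 ?mulr_gt0 ?ltr0Sn//.
    by rewrite -natr1 mulrDl mul1r [leRHS]addrC lerD2l ler_wpM2l.
  have : 4 <= c * H by rewrite mulrC -ler_pdivrMr.
  move=> cH HS; have : c * (H / d) <= 2 / d by rewrite (le_trans _ cS2)// ler_pM2l.
  by rewrite mulrA ler_pM2r ?invr_gt0//; lra.
have : H * q'%:R <= S.
  apply: le_trans Sge; rewrite mulr_suml; apply: ler_sum_nat => j _.
  have dj0 : 0 < d + j%:R / q'%:R by rewrite ltr_pwDl// divr_ge0.
  rewrite -[X in _ * X]invrK -invfM lef_pV2 ?posrE ?dj0 ?mulr_gt0 ?invr_gt0 ?ltr0Sn//.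
  by rewrite -natr1 mulrDl mul1r [leRHS]addrC lerD2r ltW.
move=> HS; have : c * (H * q'%:R) <= 2 / d.
  by rewrite (le_trans _ cS2)// ler_pM2l.
rewrite ler_pdivlMr// ler_pdivlMr ?mulr_gt0// => h.
by rewrite (le_trans _ h)// -!mulrA mulrC -!mulrA.
Qed.

End return_distance.

Section convergent_half.
Variables (R : realType) (alpha : R).
Hypotheses (alpha01 : 0 < alpha < 1) (alpha_irr : irrational alpha).

Local Notation q := (denominator alpha).
Local Notation p := (numerator alpha).
Local Notation mu := (@lebesgue_measure R).

Lemma birkhoff_sumE x N : 0 <= x < 1 ->
  birkhoff_sum alpha phi N x = \sum_(0 <= k < N) phi (frac (x + k%:R * alpha)).
Proof. by move=> x01; apply: eq_bigr => k _; rewrite iter_rotation. Qed.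

Lemma convergent_approx n :
  `|(q n)%:R * alpha - (p n)%:Z%:~R| <= (q n)%:R^-1 /\
  `|(q n)%:R * alpha - (p n)%:Z%:~R| <= (q n.+1)%:R^-1.
Proof.
have h := ltW (convergent_error_lt alpha01 alpha_irr n).
split; rewrite -[(p n)%:Z%:~R]pmulrn// (le_trans h)//.
rewrite lef_pV2 ?posrE ?ltr0n ?denominator_gt0//.
by rewrite ler_nat; exact: leq_denominatorS.
Qed.

Lemma ln_denominator_ge (c : R) : exists n0, forall n, (n0 <= n)%N ->
  c <= ln (q n)%:R.
Proof.
exists (Num.truncn (expR c)).+1 => n n0.
have qn : expR c <= (q n)%:R.
  apply: (le_trans (ltW (truncnS_gt _))); rewrite ler_nat (leq_trans n0)//.
  exact: leq_denominator_id.
by rewrite -[c]expRK ler_ln ?posrE ?expR_gt0// (lt_le_trans (expR_gt0 _) qn).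
Qed.

Lemma denominator_between n0 N : (q n0 <= N)%N ->
  exists2 n, (n0 <= n)%N & (q n <= N < q n.+1)%N.
Proof.
move=> qN.
have exN : exists n, (q n <= N)%N by exists n0.
have ubN n : (q n <= N)%N -> (n <= N)%N.
  exact/leq_trans/leq_denominator_id.
case: (ex_maxnP exN ubN) => n qnN nmax; exists n; first exact: nmax.
by rewrite qnN ltnNge; apply/negP => /nmax; rewrite ltnn.
Qed.

End convergent_half.

Section borel_cantelli_half.
Variables (R : realType) (alpha : R).
Hypotheses (alpha01 : 0 < alpha < 1) (alpha_irr : irrational alpha).

Local Notation q := (denominator alpha).
Local Notation p := (numerator alpha).
Local Notation mu := (@lebesgue_measure R).

(** The points whose orbit hits 0 have the form M - k alpha and are countable in number. Discarding
    them removes the default value of phi at 0. *)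
Lemma ae_orbit_frac_gt0 :
  {ae mu, forall x : R, forall k, 0 < frac (x + k%:R * alpha)}.
Proof.
pose f (km : nat * int) : R := km.2%:~R - km.1%:R * alpha.
have countf : countable (range f).
  exact: sub_countable (card_image_le f setT) (countableP _).
exists (range f); split.
- by apply: countable_measurable => // t; exact: measurable_set1.
- exact: countable_lebesgue_measure0.
- move=> x /= /existsNP[k /negP]; rewrite -leNgt => xk.
  have /andP[x0 _] := frac_itv (x + k%:R * alpha).
  exists (k, Num.floor (x + k%:R * alpha)) => //=.
  have : frac (x + k%:R * alpha) = 0 by apply/eqP; rewrite eq_le xk x0.
  by rewrite /frac => /eqP; rewrite subr_eq0 /f /= => /eqP <-; rewrite addrK.
Qed.

(** Pieces are empty for N < q_n and on the finitely many levels with ln q_n < 1, which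
    [near_return] does not cover. *)
Definition return_piece (c : R) (n N : nat) : set R :=
  if (q n <= N)%N && (1 <= ln (q n)%:R :> R)
  then near_set alpha N (near_radius c (q n) (q n.+1) N) else set0.

Definition return_set (c : R) (n : nat) : set R :=
  \big[setU/set0]_(N < q n.+1) return_piece c n N.

Lemma measurable_return_piece c n N : measurable (return_piece c n N).
Proof.
by rewrite /return_piece; case: ifP => // _; exact: measurable_near_set.
Qed.

Lemma measurable_return_set c n : measurable (return_set c n).
Proof.
by apply: bigsetU_measurable => N _; exact: measurable_return_piece.
Qed.

Lemma mu_return_set (c : R) : 0 < c -> exists2 A, 0 <= A &
  forall n, (mu (return_set c n) <=
    if (0 < n)%N && (2 <= q n)%N then A%:E * (W alpha n)%:E else 0)%E.
Proof.
move=> c0; have [A A0 AP] := near_radius_sum c0.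
exists (6 * A) => [|n]; first by rewrite mulr_ge0.
have [L1|L1] := lerP 1 (ln (q n)%:R : R); last first.
  rewrite /return_set big1 ?measure0.
    case: ifP => // /andP[n0 q2]; rewrite -EFinM lee_fin mulr_ge0 ?mulr_ge0//.
    by apply: level_weight_ge0; rewrite q2 leq_denominatorS.
  by move=> N _; rewrite /return_piece leNgt L1 andbF.
have q2 : (1 < q n)%N.
  by have := denominator_gt0 alpha01 alpha_irr n; case: (q n) L1 => [|[|]]//; rewrite ln1; lra.
have n0 : (0 < n)%N by case: n q2 {L1}.
rewrite n0 q2 /=.
have q12 : (1 < q n <= q n.+1)%N by rewrite q2 leq_denominatorS.
have := AP _ _ q12 L1; rewrite -[level_weight _ _ _]/(W alpha n) => AW.
apply: (@le_trans _ _ (\sum_(q n <= N < q n.+1)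
    (6 * near_radius c (q n) (q n.+1) N))%:E); last first.
  by rewrite -mulr_sumr -EFinM lee_fin -mulrA ler_pM2l.
apply: (le_trans (Boole_inequality mu _)).
  by move=> N _; exact: measurable_return_piece.
rewrite big_geq_mkord /= [in leRHS]big_mkcond /= -sumEFin.
apply: lee_sum => N _; rewrite /return_piece L1 andbT.
case: ifP => _; last by rewrite measure0.
by apply: mu_near_set; exact: near_radius_ge0.
Qed.

Lemma ae_return (c : R) : 0 < c -> (W_sum alpha < +oo)%E ->
  {ae mu, forall x : R, exists m, forall n, (m <= n)%N -> ~ return_set c n x}.
Proof.
move=> c0 Wfin; have [A A0 muA] := mu_return_set c0.
exists (lim_sup_set (return_set c)); split.
- apply: bigcap_measurable => // k _.
  by apply: bigcup_measurable => j _; exact: measurable_return_set.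
- apply: lim_sup_set_cvg0; first exact: measurable_return_set.
  (* Level 0 has measure zero and is split off, because [W_sum] starts at n = 1. *)
  rewrite (nneseries_split 0 1)// add0n.
  have -> : (\sum_(0 <= k < 1) mu (return_set c k) = 0)%E.
    rewrite big_nat1; apply/eqP; rewrite eq_le measure_ge0 andbT.
    exact: muA 0%N.
  rewrite add0e.
  apply: (@le_lt_trans _ _ (A%:E * W_sum alpha)%E); last first.
    by rewrite lte_mul_pinfty.
  have W0 n : (2 <= q n)%N -> (0 <= (W alpha n)%:E)%E.
    by move=> q2; rewrite lee_fin; apply: level_weight_ge0; rewrite q2 leq_denominatorS.
  rewrite /W_sum -nneseriesZl; last exact: W0.
  rewrite [leRHS]eseries_mkcond -[leLHS](nneseries_addn 1); last first.
    by move=> n; exact: measure_ge0.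
  rewrite -[leRHS](nneseries_addn 1); last first.
    by move=> n; case: ifP => // q2; rewrite mule_ge0 ?lee_fin// -lee_fin W0.
  apply: lee_nneseries => // n _.
  have h := muA n.+1; rewrite ltn0Sn andTb in h. by rewrite addn1.
- move=> x /= /forallNP nx k _ /=.
  have /existsNP[n /not_implyP[kn /contrapT xn]] := nx k.
  by exists n.
Qed.

Lemma limsup_ratio_eq0 : (W_sum alpha < +oo)%E ->
  {ae mu, forall x : R, x \in `[0, 1[ -> limsup_ratio alpha x = 0%:E}.
Proof.
move=> Wfin.
have ae_ret : {ae mu, forall x : R, forall j : nat, exists m, forall n,
    (m <= n)%N -> ~ return_set j.+1%:R^-1 n x}.
  by apply: ae_foralln => j; apply: ae_return => //; rewrite invr_gt0.
have F := ae_filter_ringOfSetsType mu.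
move: ae_orbit_frac_gt0 ae_ret; apply: filterS2 => x x0 xret.
rewrite in_itv /= => x01; apply: limn_esup_eq0 => [N|c c0].
  rewrite birkhoff_sumE// divr_ge0 ?sumr_ge0// => [|k _].
    by rewrite iter_rotation// ltW// phi_gt0// frac_itv.
  by rewrite ltW// phi_gt0// frac_itv.
(* The exceptional null set must not depend on c, so c is replaced by one of the countably many
   thresholds 1 / (j + 1). *)
pose j := Num.truncn c^-1.
have jc : j.+1%:R^-1 <= c.
  by rewrite invf_ple ?posrE// ltW// truncnS_gt.
have [m xm] := xret j.
have [n0 Ln0] := ln_denominator_ge alpha01 alpha_irr 1.
exists (q (maxn m n0)) => N qN.
have [n + /andP[qnN Nqn]] := denominator_between alpha01 alpha_irr qN.
rewrite geq_max => /andP[mn n0n].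
rewrite iter_rotation// birkhoff_sumE//.
set S := \sum_(_ <= _ < _) _.
have S0 : 0 < S.
  have N0 : (0 < N)%N by rewrite (leq_trans _ qnN)// denominator_gt0.
  rewrite /S big_ltn// ltr_pwDl ?phi_gt0 ?frac_itv// sumr_ge0// => k _.
  by rewrite ltW// phi_gt0// frac_itv.
rewrite ler_pdivrMr// leNgt; apply/negP => cS.
apply: (xm n mn); rewrite /return_set.
have [c1 c2] := convergent_approx alpha01 alpha_irr n.
have := @near_return R alpha (p n)%:Z (q n) (q n.+1) (denominator_gt0 alpha01 alpha_irr n)
  (denominator_gt0 alpha01 alpha_irr n.+1) (coprime_convergent alpha n)
  c1 c2 x j.+1%:R^-1 N.
rewrite invr_gt0 ltr0Sn Ln0// => /(_ isT isT qnN x0)[].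
  by rewrite (le_trans _ (ltW cS))// ler_pM2r.
move=> M /(near_setP x01) xN.
rewrite -(bigcup_mkord (q n.+1) (return_piece j.+1%:R^-1 n)).
by exists N => //; rewrite /return_piece qnN Ln0.
Qed.

End borel_cantelli_half.

(** * The divergent half *)

Lemma lnS_le (R : realType) (k : nat) : (0 < k)%N ->
  ln k.+1%:R <= ln k%:R + 1 :> R.
Proof.
move=> k0; have /andP[_ ln2] := ln2_bounds R.
have : ln k.+1%:R <= ln (k%:R * 2) :> R.
  rewrite ler_ln ?posrE ?mulr_gt0 ?ltr0n// -natrM ler_nat.
  by rewrite muln2 -addnn -addn1 leq_add2l.
by rewrite lnM ?posrE ?ltr0n//; lra.
Qed.

Lemma lnS_le5 (R : realType) (k : nat) : (0 < k)%N -> 1 <= ln k%:R :> R ->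
  2 * ln k.+1%:R + 1 <= 5 * ln k%:R :> R.
Proof. by move=> /(lnS_le R) ? ?; lra. Qed.

Lemma lnS_le3 (R : realType) (k : nat) : (0 < k)%N ->
  2 * ln k.+1%:R + 1 <= 3 * (1 + ln k%:R) :> R.
Proof.
move=> k0; have := lnS_le R k0.
by have : 0 <= ln k%:R :> R; [rewrite ln_ge0// ler1n | lra].
Qed.

(** * Upper bounds for Birkhoff sums at return times *)

Section return_ratio.
Variables (R : realType) (alpha : R) (q b N : nat) (E : R).

Definition spaced (T : nat) (d : R) := forall (k : nat) (m : int),
  (0 < k < T)%N -> d <= `|k%:R * alpha - m%:~R|.

Lemma frac_sub (x : R) k l : (k <= l)%N -> exists m : int,
  frac (x + l%:R * alpha) - frac (x + k%:R * alpha) =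
  (l - k)%N%:R * alpha - m%:~R.
Proof.
move=> kl; exists (Num.floor (x + l%:R * alpha) - Num.floor (x + k%:R * alpha)).
by rewrite /frac natrB// intrB; ring.
Qed.

Lemma separated_frac (x : R) (T : nat) d (s : seq nat) : spaced T d ->
  {in s &, forall k l : nat, (k < l)%N -> (l - k < T)%N} ->
  separated d s (fun k => frac (x + k%:R * alpha)).
Proof.
move=> sp sT; suff h k l : k \in s -> l \in s -> (k < l)%N ->
    d <= `|frac (x + k%:R * alpha) - frac (x + l%:R * alpha)|.
  move=> k l ks ls; case: ltngtP => // kl _; first exact: h.
  by rewrite distrC; exact: h.
move=> ks ls kl; rewrite distrC; have [m ->] := frac_sub x (ltnW kl).
by apply: sp; rewrite subn_gt0 kl /= sT.
Qed.

Hypotheses (q0 : (0 < q)%N) (E0 : 0 < E) (Nb : (N <= b * q)%N)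
  (spq : spaced q (2 * q%:R)^-1) (spE : spaced N.+1 (2 * E)^-1).

(** The N-th point is within 1 / (4 E) after 0 and the others are at least 1 / (2 E) from it on the
    circle, so they stay 1 / (4 E) away from 0 on both sides. Then [sum_inv_blocks] bounds the sums
    of 1 / y and of 1 / (1 - y), whence the factor 2. *)
Lemma sum_phi_le (x : R) : frac (x + N%:R * alpha) <= (4 * E)^-1 ->
  \sum_(0 <= k < N) phi (frac (x + k%:R * alpha)) <=
  2 * (2 * q%:R * b%:R * (2 * ln q.+1%:R + 1) + 4 * E * (2 * ln b.+1%:R + 1)).
Proof.
move=> yN; have := frac_itv (x + N%:R * alpha).
set z := frac (x + N%:R * alpha) in yN * => /andP[z0 z1].
pose y k := frac (x + k%:R * alpha).
have E2 : (2 * E)^-1 = (4 * E)^-1 + (4 * E)^-1.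
  by field; rewrite gt_eqF.
have far k : (k < N)%N -> (4 * E)^-1 <= y k /\ (4 * E)^-1 <= 1 - y k.
  move=> kN; have [m zy] := frac_sub x (ltnW kN); rewrite -/z -/(y k) in zy.
  have /andP[y0 y1] := frac_itv (x + k%:R * alpha); rewrite -/(y k) in y0 y1.
  have Nk : (0 < N - k < N.+1)%N by rewrite subn_gt0 kN ltnS leq_subr.
  split.
    have := spE m Nk; rewrite -zy leNgt ltr_norml => /negP h.
    by rewrite leNgt; apply/negP => yk; apply: h; apply/andP; split; lra.
  have := spE (m - 1) Nk.
  have -> : (N - k)%N%:R * alpha - (m - 1)%:~R = z - y k + 1.
    by rewrite zy intrB; ring.
  by rewrite ger0_norm; lra.
have sepE : separated (2 * E)^-1 (index_iota 0 N) y.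
  by apply: separated_frac spE _ => k l; rewrite !mem_index_iota => ? ?; lia.
have sepq i : separated (2 * q%:R)^-1
    [seq k <- index_iota 0 N | (k %/ q == i)%N] y.
  apply: separated_frac spq _ => k l; rewrite !mem_filter.
  move=> /andP[/eqP ki _] /andP[/eqP li _].
  have := divn_eq k q; have := divn_eq l q; rewrite ki li.
  have := ltn_pmod k q0; have := ltn_pmod l q0; move: (i * q)%N => iq; lia.
have sym d s : separated d s y -> separated d s (fun k => 1 - y k).
  move=> sep k l ks ls kl; rewrite (_ : 1 - y k - (1 - y l) = y l - y k); last by ring.
  by rewrite distrC; exact: sep.
rewrite mulr_natl mulr2n /phi big_split /= lerD//.
  apply: sum_inv_blocks => // k; rewrite mem_index_iota => kN.
  by have [] := far k kN.
apply: (sum_inv_blocks (y := fun k => 1 - y k)) => //.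
- by move=> k; rewrite mem_index_iota => kN; have [] := far k kN.
- exact: sym.
- by move=> i; exact: sym.
Qed.

Hypotheses (L1 : 1 <= ln q%:R :> R) (b0 : (0 < b)%N)
  (Eb : E * (1 + ln b%:R) <= 2 * (b%:R * q%:R * ln q%:R)).

Lemma half_le_block_sum : E / 2 <= b%:R * q%:R * ln q%:R.
Proof.
have lnb : 0 <= ln b%:R :> R by rewrite ln_ge0// ler1n.
have : E <= E * (1 + ln b%:R) by rewrite ler_peMr ?lerDl// ltW.
rewrite ler_pdivrMr// [_ * 2]mulrC => h; exact: le_trans h Eb.
Qed.

(** With X = b q ln q, the two terms in [sum_phi_le] are at most 10 X and, by [Eb], 24 X, so that
    S_N <= 2 (10 + 24) X = 68 X. *)
Lemma phi_return_ge (x C : R) : 1 <= C ->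
  0 < frac (x + N%:R * alpha) <= (68 * C * (b%:R * q%:R * ln q%:R))^-1 ->
  C * \sum_(0 <= k < N) phi (frac (x + k%:R * alpha)) <=
  phi (frac (x + N%:R * alpha)).
Proof.
move=> C1 /andP[y0 yr].
have bqL := half_le_block_sum; set X := b%:R * q%:R * ln q%:R in bqL yr *.
have X0 : 0 < X by rewrite (lt_le_trans _ bqL)// divr_gt0.
have EX : E * (1 + ln b%:R) <= 2 * X by exact: Eb.
have XE : X = b%:R * q%:R * ln q%:R by [].
clearbody X.
have CX0 : 0 < 68 * C * X by rewrite mulr_gt0// mulr_gt0//; lra.
have yE : frac (x + N%:R * alpha) <= (4 * E)^-1.
  apply: (le_trans yr); rewrite lef_pV2 ?posrE ?mulr_gt0//; nra.
have lnb : 0 <= ln b%:R :> R by rewrite ln_ge0// ler1n.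
have S68 : \sum_(0 <= k < N) phi (frac (x + k%:R * alpha)) <= 68 * X.
  apply: (le_trans (sum_phi_le yE)).
  have h1 : 2 * q%:R * b%:R * (2 * ln q.+1%:R + 1) <= 10 * X.
    have -> : 10 * X = 2 * q%:R * b%:R * (5 * ln q%:R) by rewrite XE; ring.
    by rewrite ler_pM2l ?mulr_gt0 ?ltr0n// lnS_le5.
  have h2 : 4 * E * (2 * ln b.+1%:R + 1) <= 24 * X.
    have : 4 * E * (2 * ln b.+1%:R + 1) <= 4 * E * (3 * (1 + ln b%:R)).
      by rewrite ler_pM2l ?mulr_gt0// lnS_le3.
    have : 4 * E * (3 * (1 + ln b%:R)) = 12 * (E * (1 + ln b%:R)) by ring.
    by lra.
  lra.
have /andP[_ y1] := frac_itv (x + N%:R * alpha).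
apply: (le_trans _ (phi_ge_inv _)); last by rewrite y0.
apply: (@le_trans _ _ (68 * C * X)).
  by rewrite -mulrA mulrCA ler_pM2l//; lra.
by rewrite -[leLHS]invrK lef_pV2 ?posrE ?invr_gt0.
Qed.

End return_ratio.

(** * Lebesgue density and the second moment method *)

Section density.
Variable R : realType.
Local Notation mu := (@lebesgue_measure R).

(* By Lebesgue's density theorem almost every point outside E is a point of
   density 0 of E, which the uniform lower bound excludes. *)
Lemma ae_of_uniform_density (E : set R) (kappa : R) : measurable E -> 0 < kappa ->
  (forall a b : R, 0 < a -> a < b -> b < 1 ->
    ((kappa * (b - a))%:E <= mu (E `&` `]a, b[))%E) ->
  {ae mu, forall x, 0 < x < 1 -> E x}.
Proof.
move=> mE kappa0 Elow; have := lebesgue_density mE.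
have F := ae_filter_ringOfSetsType mu.
apply: filterS => x cvgx /andP[x0 x1]; apply: contrapT => Ex.
move: cvgx; rewrite indicE memNset//= => cvg0.
suff : (kappa%:E <= 0)%E by rewrite lee_fin leNgt kappa0.
apply: cvge_to_ge cvg0 _.
near=> r.
have r0 : 0 < r by [].
have xr0 : 0 < x - r by rewrite subr_gt0; near: r; exact: nbhs_right_lt.
have xr1 : x + r < 1.
  by rewrite -ltrBrDl; near: r; apply: nbhs_right_lt; rewrite subr_gt0.
rewrite lebesgue_measure_ball ?(ltW r0)// inver mulrn_eq0 /= gt_eqF//.
rewrite lee_pdivlMr ?mulrn_wgt0// -EFinM ball_itv.
have xr : x - r < x + r by lra.
by apply: le_trans (Elow _ _ xr0 xr xr1); rewrite lee_fin ler_pM2l// mulr2n; lra.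
Unshelve. all: by end_near. Qed.

(* Integrate 1_U >= 2 t f - t^2 f^2, where f counts the sets F i containing a
   point, for t = A / B. *)
Lemma second_moment (I : eqType) (s : seq I) (F : I -> set R) (U : set R)
    (A B : R) (m : I -> R) (o : I -> I -> R) :
  (forall i, measurable (F i)) -> measurable U ->
  (forall i, i \in s -> F i `<=` U) ->
  (forall i, mu (F i) = (m i)%:E) -> A <= \sum_(i <- s) m i ->
  (forall i j, (mu (F i `&` F j) <= (o i j)%:E)%E) ->
  \sum_(i <- s) \sum_(j <- s) o i j <= B -> 0 <= A -> 0 < B ->
  ((A ^+ 2 / B)%:E <= mu U)%E.
Proof.
move=> mF mU FU muF AE muFF oB A0 B0.
pose t := A / B; have t0 : 0 <= t by rewrite divr_ge0// ltW.
pose f x : R := \sum_(i <- s) \1_(F i) x.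
pose g x : R := \sum_(i <- s) \sum_(j <- s) \1_(F i `&` F j) x.
have fg x : f x ^+ 2 = g x.
  rewrite expr2 /f /g mulr_suml; apply: eq_bigr => i _.
  by rewrite mulr_sumr; apply: eq_bigr => j _; rewrite indicI.
(* On U the difference of the two sides is (1 - t f)^2; off U the function f vanishes. *)
have ptw x : 2 * t * f x <= \1_U x + t ^+ 2 * g x.
  rewrite -fg; have [Ux|Ux] := pselect (U x).
    rewrite indicE mem_set//= -subr_ge0.
    rewrite (_ : _ - _ = (1 - t * f x) ^+ 2) ?sqr_ge0//; ring.
  have -> : f x = 0.
    rewrite /f big_seq big1// => i si.
    by rewrite indicE memNset// => /(FU _ si).
  by rewrite expr0n /= !mulr0 addr0 indicE.
have mI (X : set R) : measurable X -> measurable_fun setT (EFin \o (\1_X : R -> R)).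
  by move=> mX; apply/measurable_EFinP; exact: measurable_indic.
have I0 (X : set R) x : (0 <= (\1_X x)%:E :> \bar R)%E by rewrite lee_fin.
have intI (X : set R) : measurable X -> (\int[mu]_x (\1_X x)%:E = mu X)%E.
  by move=> mX; rewrite integral_indic// setIT.
have mFF i j : measurable (F i `&` F j) by apply: measurableI.
pose ef x : \bar R := (\sum_(i <- s) (\1_(F i) x)%:E)%E.
pose eg x : \bar R := (\sum_(i <- s) \sum_(j <- s) (\1_(F i `&` F j) x)%:E)%E.
have efE x : ef x = (f x)%:E by rewrite /ef sumEFin.
have egE x : eg x = (g x)%:E.
  by rewrite /eg /g -sumEFin; apply: eq_bigr => i _; rewrite sumEFin.
have mef : measurable_fun setT ef by apply: emeasurable_sum => i; exact: mI.
have meg : measurable_fun setT eg.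
  by apply: emeasurable_sum => i; apply: emeasurable_sum => j; exact: mI.
have ef0 x : (0 <= ef x)%E by apply: sume_ge0 => i _.
have eg0 x : (0 <= eg x)%E by apply: sume_ge0 => i _; apply: sume_ge0 => j _.
have intef : (\int[mu]_x ef x = (\sum_(i <- s) m i)%:E)%E.
  rewrite ge0_integral_sum//; last by move=> i; exact: mI.
  by rewrite -sumEFin; apply: eq_bigr => i _; rewrite intI.
have integ : (\int[mu]_x eg x <= B%:E)%E.
  rewrite ge0_integral_sum//; last 2 first.
  - by move=> i; apply: emeasurable_sum => j; exact: mI.
  - by move=> i x _; apply: sume_ge0.
  apply: (@le_trans _ _ (\sum_(i <- s) \sum_(j <- s) o i j)%:E); last by rewrite lee_fin.
  rewrite -sumEFin; apply: lee_sum => i _.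
  rewrite ge0_integral_sum//; last by move=> j; exact: mI.
  by rewrite -sumEFin; apply: lee_sum => j _; rewrite intI.
have key : (\int[mu]_x ((2 * t)%:E * ef x) <=
    \int[mu]_x ((\1_U x)%:E + (t ^+ 2)%:E * eg x))%E.
  apply: ge0_le_integral => //.
  - by move=> x _; rewrite mule_ge0// lee_fin mulr_ge0.
  - by apply: measurable_funeM.
  - by apply: emeasurable_funD; [exact: mI | exact: measurable_funeM].
  - by move=> x _; rewrite efE egE -!EFinM -EFinD lee_fin.
rewrite ge0_integralZl_EFin// in key; last by rewrite mulr_ge0.
rewrite ge0_integralD// in key; last 3 first.
- exact: mI.
- by move=> x _; rewrite mule_ge0// lee_fin sqr_ge0.
- exact: measurable_funeM.
rewrite ge0_integralZl_EFin ?sqr_ge0// intef intI// in key.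
have key2 : ((2 * t * A)%:E <= mu U + (t ^+ 2 * B)%:E)%E.
  apply: (@le_trans _ _ ((2 * t)%:E * (\sum_(i <- s) m i)%:E)%E).
    by rewrite -EFinM lee_fin ler_wpM2l// mulr_ge0.
  apply: (le_trans key); rewrite [(t ^+ 2 * B)%:E]EFinM; apply: leeD2l.
  by apply: lee_wpmul2l; rewrite ?lee_fin ?sqr_ge0.
have [Ufin|Uinf] := boolP (mu U \is a fin_num); last first.
  move: Uinf; rewrite ge0_fin_numE// -leNgt leye_eq => /eqP ->.
  by rewrite leey.
move: key2; rewrite -(fineK Ufin) -EFinD !lee_fin /t => h.
have e1 : A ^+ 2 / B = 2 * (A / B) * A - (A / B) ^+ 2 * B.
  by field; rewrite gt_eqF.
by rewrite e1 lerBlDr.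
Qed.

End density.

(* x + N alpha is within r after 0 on the circle iff x is within r after this
   point. The arcs are taken on one side because phi 0 is a junk value. *)
Definition arc_start {R : realType} (alpha : R) (N : nat) : R := frac (N%:R * - alpha).

(** For K = 68 C this is the radius in [phi_return_ge] for a time in block j, which lies within the
    first b = j + 1 blocks. *)
Definition block_length {R : realType} (K : R) (q j : nat) : R :=
  (K * (j.+1%:R * q%:R * ln q%:R))^-1.

(** The total length of the arcs of one level, q of them in each block. *)
Definition level_weight_sum {R : realType} (K : R) (q u v : nat) : R :=
  \sum_(u <= j < v) block_length K q j * q%:R.

Definition level_seq {R : realType} (alpha : R) (q u v m : nat) (a b : R) :
    seq nat :=
  [seq N <- index_iota (u * q) (v * q) | (m <= N)%N && (a < arc_start alpha N < b)].

Lemma spacedN (R : realType) (alpha : R) T d :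
  spaced alpha T d -> spaced (- alpha) T d.
Proof.
move=> sp k m kT; have := sp k (- m) kT.
by rewrite intrN opprK mulrN -[X in _ -> _ <= X]normrN opprD !opprK.
Qed.

(** * Counting the arcs of one level *)

Section one_level.
Variables (R : realType) (alpha : R) (p : int) (q u v e m : nat) (K : R).
Hypotheses (q0 : (0 < q)%N) (copq : coprimez p q%:Z)
  (alphapq : `|q%:R * alpha - p%:~R| <= q%:R^-1)
  (spq : spaced alpha q (2 * q%:R)^-1) (spe : spaced alpha e (2 * e%:R)^-1)
  (L1 : 1 <= ln q%:R :> R) (ve : (v * q <= e)%N) (e0 : (0 < e)%N)
  (eL : forall j, (u <= j < v)%N ->
    e%:R * (1 + ln j.+1%:R) <= 2 * (j.+1%:R * q%:R * ln q%:R) :> R)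
  (K68 : 68 <= K).

Local Notation c := (arc_start alpha).
Local Notation r := (block_length K q).
Local Notation w := (level_weight_sum K q u v).

Let qR0 : (0 : R) < q%:R. Proof. by rewrite ltr0n. Qed.
Let eR0 : (0 : R) < e%:R. Proof. by rewrite ltr0n. Qed.
Let L0 : 0 < ln q%:R :> R. Proof. exact: lt_le_trans L1. Qed.
Let K0 : 0 < K. Proof. exact: lt_le_trans K68. Qed.

Lemma block_length_gt0 j : 0 < r j.
Proof. by rewrite invr_gt0 !mulr_gt0 ?ltr0Sn. Qed.

Lemma level_weight_sum_ge0 : 0 <= w.
Proof. by rewrite sumr_ge0// => j _; rewrite mulr_ge0// ltW// block_length_gt0. Qed.

(** The bound is half the spacing of the arc starts, which makes the arcs of one level disjoint. By
    [eL], e is at most twice X = (j + 1) q ln q, so 4 e <= 8 X <= K X. *)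
Lemma block_length_le j : (u <= j < v)%N -> r j <= (4 * e%:R)^-1.
Proof.
move=> uv; have eLj := eL uv.
have lnj : 0 <= ln j.+1%:R :> R by rewrite ln_ge0// ler1n.
rewrite lef_pV2 ?posrE ?mulr_gt0 ?ltr0Sn//.
set X := j.+1%:R * q%:R * ln q%:R in eLj *.
have h : e%:R <= 2 * X.
  by apply: le_trans eLj; rewrite ler_peMr ?lerDl// ltW.
have X0 : 0 < X by rewrite !mulr_gt0// ltr0Sn.
apply: (@le_trans _ _ (68 * X)); last by rewrite ler_pM2r.
have : 4 * e%:R <= 4 * (2 * X) by rewrite ler_pM2l.
by move/le_trans; apply; rewrite mulrA ler_pM2r// -natrM ler_nat.
Qed.

Lemma sum_index_blocks (F : nat -> R) :
  \sum_(u * q <= N < v * q) F N = \sum_(u <= j < v) \sum_(0 <= i < q) F (j * q + i)%N.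
Proof.
have [vu|uv] := leqP v u; first by rewrite !big_geq// leq_mul.
elim: v uv => // t IH; rewrite ltnS leq_eqVlt => /predU1P[<-|ut].
  rewrite big_nat1 mulSn -{1}[(u * q)%N]add0n big_addn addnK.
  by apply: eq_bigr => i _; rewrite addnC.
rewrite big_nat_recr ?(ltnW ut)//= -IH//.
rewrite (big_cat_nat _ _ (n := (t * q)%N)) ?leq_mul2r
  ?(ltnW ut) ?leqnSn ?orbT//=.
congr (_ + _); rewrite mulSn -{1}[(t * q)%N]add0n big_addn addnK.
by apply: eq_bigr => i _; rewrite addnC.
Qed.

Lemma sum_level (P : pred nat) (G : nat -> R) :
  \sum_(u * q <= N < v * q | P N) G (N %/ q)%N =
  \sum_(u <= j < v) G j * (count (fun i => P (j * q + i)%N) (index_iota 0 q))%:R.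
Proof.
rewrite big_mkcond /= sum_index_blocks; apply: eq_bigr => j _.
rewrite -sum1_count natr_sum mulr_sumr [RHS]big_mkcond /=.
apply: eq_big_nat => i /andP[_ iq].
rewrite divnMDl// divn_small// addn0; case: ifP => _; last by rewrite ?mulr0.
by rewrite mulr1.
Qed.

Lemma count_level_le (j : nat) (a l : R) : 0 <= l ->
  (count (fun i => a <= c (j * q + i)%N <= a + l) (index_iota 0 q))%:R
    <= 2 * q%:R * l + 1 :> R.
Proof.
move=> l0.
have := @count_separated R (2 * q%:R)^-1 a l (index_iota 0 q)
  (fun i => c (j * q + i)%N).
rewrite invr_gt0 mulr_gt0// invrK [l * _]mulrC; apply => //; first exact: iota_uniq.
pose x := (j * q)%N%:R * - alpha.
have ce i : c (j * q + i)%N = frac (x + i%:R * - alpha).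
  by rewrite /arc_start natrD mulrDl.
have sep : separated (2 * q%:R)^-1 (index_iota 0 q)
    (fun i => frac (x + i%:R * - alpha)).
  apply: separated_frac (spacedN spq) _ => s t.
  rewrite !mem_index_iota => /andP[_ sq] /andP[_ tq] st.
  by rewrite (leq_ltn_trans _ tq)// leq_subr.
by move=> k k' ks ks' kk; rewrite !ce; exact: sep.
Qed.

(* The last term pays for the times N < m. *)
Lemma count_level_ge (j : nat) (a b : R) : 0 <= a -> b <= 1 ->
  (b - a) * q%:R - 6 - m%:R <=
  (count (fun i => (m <= j * q + i)%N && (a < c (j * q + i)%N < b))
    (index_iota 0 q))%:R.
Proof.
move=> a0 b1.
have alphapq' : `|q%:R * - alpha - (- p)%:~R| <= q%:R^-1.
  by rewrite intrN mulrN -opprD normrN.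
have copq' : coprimez (- p) q%:Z by rewrite coprimeNz.
pose x := (j * q)%N%:R * - alpha.
have := count_block_ge q0 copq' alphapq' x a0 b1.
have ce i : c (j * q + i)%N = frac (x + i%:R * - alpha).
  by rewrite /arc_start natrD mulrDl.
rewrite (eq_count (a2 := fun i => a < c (j * q + i)%N < b)); last first.
  by move=> i; rewrite ce.
set A := fun i => a < _ < b.
set B := fun i => (m <= j * q + i)%N && A i.
move=> h; rewrite lerBlDr; apply: (le_trans h).
rewrite -natrD ler_nat.
apply: (@leq_trans (count (predU B (fun i => i < m)%N) (index_iota 0 q))).
  apply: sub_count => i Ai /=; rewrite /B Ai andbT.
  by case: (leqP m i) => [mi|]; rewrite ?orbT// (leq_trans mi) ?leq_addl.
rewrite -(leq_add2r (count (predI B (fun i => i < m)%N) (index_iota 0 q))).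
rewrite count_predUI -addnA leq_add2l (leq_trans _ (leq_addr _ _))//.
rewrite -size_filter -[leqRHS](size_iota 0 m).
apply: uniq_leq_size; first by rewrite filter_uniq// iota_uniq.
by move=> i; rewrite mem_filter mem_iota /= add0n => /andP[].
Qed.

Lemma sum_level_seq (a b : R) (G : nat -> R) :
  \sum_(N <- level_seq alpha q u v m a b) G (N %/ q)%N =
  \sum_(u <= j < v) G j * (count (fun i => (m <= j * q + i)%N &&
    (a < c (j * q + i)%N < b)) (index_iota 0 q))%:R.
Proof. by rewrite big_filter sum_level. Qed.

(** Each block has at least (b - a) q - 6 - m arcs starting in the interval, and the size assumption
    makes the loss at most one half. *)
Lemma mass_ge (a b : R) : 0 <= a -> b <= 1 ->
  2 * (6 + m%:R) <= (b - a) * q%:R ->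
  (b - a) / 2 * w <= \sum_(N <- level_seq alpha q u v m a b) r (N %/ q)%N.
Proof.
move=> a0 b1 abq; rewrite sum_level_seq mulr_sumr; apply: ler_sum => j _.
rewrite mulrCA ler_pM2l ?block_length_gt0//.
apply: le_trans (count_level_ge _ a0 b1).
by lra.
Qed.

Lemma count_level_seq_le (j : nat) (a b : R) : 1 <= (b - a) * q%:R ->
  (count (fun i => (m <= j * q + i)%N &&
    (a < c (j * q + i)%N < b)) (index_iota 0 q))%:R <= 3 * (b - a) * q%:R :> R.
Proof.
move=> abq; have ab : 0 <= b - a.
  by rewrite -(pmulr_lge0 _ qR0); exact: le_trans ler01 abq.
apply: (@le_trans _ _ (2 * q%:R * (b - a) + 1)); last by lra.
apply: le_trans (count_level_le j a ab); rewrite ler_nat.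
by apply: sub_count => i /= /andP[_ /andP[h1 h2]]; apply/andP; split; lra.
Qed.

Lemma mass_le (a b : R) : 1 <= (b - a) * q%:R ->
  \sum_(N <- level_seq alpha q u v m a b) r (N %/ q)%N <= 3 * (b - a) * w.
Proof.
move=> abq; rewrite sum_level_seq mulr_sumr; apply: ler_sum => j _.
rewrite mulrCA ler_pM2l ?block_length_gt0//; exact: count_level_seq_le.
Qed.

Lemma size_level_seq_le (a b : R) : 1 <= (b - a) * q%:R ->
  \sum_(N <- level_seq alpha q u v m a b) 1 <= 3 * (b - a) * e%:R.
Proof.
move=> abq; rewrite (sum_level_seq a b (fun=> 1)).
apply: (@le_trans _ _ (\sum_(0 <= j < v) 3 * (b - a) * q%:R)).
  have abq0 : 0 <= (b - a) * q%:R by exact: le_trans ler01 abq.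
  have h0 : 0 <= 3 * (b - a) * q%:R by rewrite -mulrA mulr_ge0.
  apply: (@le_trans _ _ (\sum_(u <= j < v) 3 * (b - a) * q%:R)).
    by apply: ler_sum => j _; rewrite mul1r; exact: count_level_seq_le.
  apply: ler_sum_sub => //; rewrite ?iota_uniq// => k.
  by rewrite !mem_index_iota => /andP[_ ->].
rewrite sumr_const_nat subn0 -[_ *+ v]mulr_natr -[_ * v%:R]mulrA -natrM mulnC.
have ab : 0 <= b - a.
  by rewrite -(pmulr_lge0 _ qR0); exact: le_trans ler01 abq.
by rewrite ler_wpM2l ?mulr_ge0// ler_nat.
Qed.

(** The window may be shorter than 1 / q, so the rounding error of the count cannot be absorbed and
    remains as w / q. *)
Lemma window_mass_le (a l : R) : 0 <= l ->
  \sum_(u * q <= N < v * q | a <= c N <= a + l) r (N %/ q)%N <=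
  w * (2 * l + q%:R^-1).
Proof.
move=> l0; rewrite sum_level mulr_suml; apply: ler_sum => j _.
rewrite -mulrA ler_pM2l ?block_length_gt0// (le_trans (count_level_le _ _ l0))//.
rewrite mulrDr mulfV ?gt_eqF// lerD2r; lra.
Qed.

Lemma level_separated N N' : (N < v * q)%N -> (N' < v * q)%N -> N != N' ->
  (2 * e%:R)^-1 <= `|c N - c N'|.
Proof.
move=> Nv N'v NN'.
have sep : separated (2 * e%:R)^-1 (index_iota 0 (v * q))
    (fun i => frac (0 + i%:R * - alpha)).
  apply: separated_frac (spacedN spe) _ => s t.
  rewrite !mem_index_iota => /andP[_ sq] /andP[_ tq] st.
  by rewrite (leq_ltn_trans _ (leq_trans tq ve))// leq_subr.
have := sep N N'; rewrite !mem_index_iota !add0r => h.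
by apply: h.
Qed.

End one_level.

Section arcs.
Variable R : realType.
Local Notation mu := (@lebesgue_measure R).

(** Bounds the length of the intersection of two arcs by that of the shorter one as soon as they
    meet. *)
Definition overlap (c r c' r' : R) : R :=
  if (c - r' < c') && (c' < c + r) then Num.min r r' else 0.

Definition arc (c r : R) : set R := `]c, c + r[%classic.

Lemma measurable_arc c r : measurable (arc c r).
Proof. exact: measurable_itv. Qed.

Lemma mu_arc (c r : R) : 0 <= r -> mu (arc c r) = r%:E.
Proof.
move=> r0; rewrite /arc lebesgue_measure_itv /= lte_fin ltrDl.
case: ltP => [_|r1]; first by rewrite -EFinB addrAC subrr add0r.
by congr EFin; apply/eqP; rewrite eq_le r0 r1.
Qed.

Lemma overlapC c r c' r' : overlap c r c' r' = overlap c' r' c r.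
Proof.
rewrite /overlap minC; congr (if _ then _ else _).
by rewrite andbC ltrBlDr ltrBlDr.
Qed.

Lemma mu_overlap c r c' r' : 0 <= r -> 0 <= r' ->
  (mu (arc c r `&` arc c' r') <= (overlap c r c' r')%:E)%E.
Proof.
move=> r0 r'0; rewrite /overlap; case: ifPn => [_|h].
  rewrite EFin_min le_min -[leRHS](mu_arc c r0) -[X in _ && (_ <= X)%E](mu_arc c' r'0).
  by rewrite !le_measure ?inE//;
    try apply: measurableI; exact: measurable_arc.
rewrite (_ : _ `&` _ = set0) ?measure0//.
rewrite -subset0 => x /= []; rewrite /arc /= !in_itv /= => /andP[h1 h2] /andP[h3 h4].
by apply: (negP h); apply/andP; split; lra.
Qed.

End arcs.

(** * Quasi-independence of the levels *)

Section level_family.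
Variables (R : realType) (alpha : R) (u v e : nat -> nat) (n1 m : nat) (K : R).
Hypotheses (alpha01 : 0 < alpha < 1) (alpha_irr : irrational alpha).

Local Notation q := (denominator alpha).
Local Notation p := (numerator alpha).
Local Notation mu := (@lebesgue_measure R).
Local Notation c := (arc_start alpha).

Hypotheses (n1_gt0 : (0 < n1)%N) (K68 : 68 <= K)
  (L1 : forall n, (n1 <= n)%N -> 1 <= ln (q n)%:R :> R)
  (ve : forall n, (n1 <= n)%N -> (v n * q n <= e n)%N)
  (e0 : forall n, (n1 <= n)%N -> (0 < e n)%N)
  (eq : forall n, (n1 <= n)%N -> (e n <= q n.+1)%N)
  (spe : forall n, (n1 <= n)%N -> spaced alpha (e n) (2 * (e n)%:R)^-1)
  (eL : forall n, (n1 <= n)%N -> forall j, (u n <= j < v n)%N ->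
    (e n)%:R * (1 + ln j.+1%:R) <= 2 * (j.+1%:R * (q n)%:R * ln (q n)%:R) :> R).

Definition arc_length n N := block_length K (q n) (N %/ q n).
Definition arc_of (x : nat * nat) : set R := arc (c x.2) (arc_length x.1 x.2).

Local Notation w n := (level_weight_sum K (q n) (u n) (v n)).
Local Notation levels n a b := (level_seq alpha (q n) (u n) (v n) m a b).

Let q0 n : (0 < q n)%N. Proof. exact: denominator_gt0. Qed.
Let qR0 n : (0 : R) < (q n)%:R. Proof. by rewrite ltr0n. Qed.

Lemma spaced_denominator n : (0 < n)%N -> spaced alpha (q n) (2 * (q n)%:R)^-1.
Proof. by case: n => // n _ k mz kq; exact: best_approximation. Qed.

Lemma level_seqP n a b N : N \in levels n a b ->
  [/\ (u n * q n <= N < v n * q n)%N, (m <= N)%N, (u n <= N %/ q n < v n)%N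
    & a < c N < b].
Proof.
rewrite mem_filter mem_index_iota => /andP[/andP[mN cN] NI]; split => //.
by rewrite leq_divRL// ltn_divLR.
Qed.

Lemma arc_length_gt0 n N : (n1 <= n)%N -> 0 < arc_length n N.
Proof. by move=> nn; apply: block_length_gt0 => //; exact: L1. Qed.

(** Arcs do not grow with the level: (j + 1) q_n <= v q_n <= e <= q_(n+1) <= q_n'. *)
Lemma arc_length_le n n' a b a' b' N N' : (n1 <= n)%N -> (n < n')%N ->
  N \in levels n a b -> N' \in levels n' a' b' ->
  arc_length n' N' <= arc_length n N.
Proof.
move=> nn nn' /level_seqP[_ _ /andP[_ jv] _] _.
have L0 : 0 < ln (q n)%:R :> R by exact: lt_le_trans (L1 nn).
have n'n : (n1 <= n')%N by exact: leq_trans (ltnW nn').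
have L0' : 0 < ln (q n')%:R :> R by exact: lt_le_trans (L1 n'n).
have K0 : 0 < K by exact: lt_le_trans K68.
rewrite lef_pV2 ?posrE ?mulr_gt0 ?ltr0Sn// ler_pM2l//.
have qq : (q n <= q n')%N by apply: leq_denominator => //; exact: ltnW.
apply: ler_pM; rewrite ?mulr_ge0 ?ler0n ?(ltW L0)//.
  rewrite -!natrM ler_nat.
  apply: (@leq_trans (q n')); last by rewrite leq_pmull.
  apply: (@leq_trans (e n)); first by rewrite (leq_trans _ (ve nn))// leq_mul2r jv orbT.
  by rewrite (leq_trans (eq nn))// leq_denominator.
by rewrite ler_ln ?posrE// ler_nat.
Qed.

(** The arcs of level n' are no longer than an arc of length r of level n, so those meeting it start
    in a window of length 2 r, and their mass is at most w' (4 r + 1 / q'). Summing over level n,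
    its total mass gives the 12 and its number of arcs the 3. *)
Lemma overlap_cross n n' a b : (n1 <= n)%N -> (n < n')%N ->
  1 <= (b - a) * (q n)%:R ->
  \sum_(N <- levels n a b) \sum_(N' <- levels n' a b)
    overlap (c N) (arc_length n N) (c N') (arc_length n' N') <=
  w n' * (b - a) * (12 * w n + 3 * ((q n.+1)%:R / (q n')%:R)).
Proof.
move=> nn nn' abq.
have n'n : (n1 <= n')%N by exact: leq_trans (ltnW nn').
have n'0 : (0 < n')%N by exact: leq_trans n'n.
have n0 : (0 < n)%N by exact: leq_trans nn.
have w'0 : 0 <= w n' by apply: level_weight_sum_ge0 => //; exact: L1.
apply: (@le_trans _ _ (\sum_(N <- levels n a b)
    w n' * (4 * arc_length n N + (q n')%:R^-1))).
  rewrite big_seq [leRHS]big_seq; apply: ler_sum => N NI.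
  have r0 : 0 < arc_length n N by exact: arc_length_gt0.
  have e4 : 4 * arc_length n N = 2 * (2 * arc_length n N) by ring.
  rewrite e4.
  apply: le_trans (window_mass_le (u n') (v n') (q0 n') (spaced_denominator n'0)
    (L1 n'n) K68 (c N - arc_length n N) _); last by rewrite mulr_ge0// ltW.
  rewrite big_seq.
  apply: (@le_trans _ _ (\sum_(N' <- levels n' a b |
     c N - arc_length n N <= c N' <= c N - arc_length n N + 2 * arc_length n N)
     arc_length n' N')).
    rewrite [leRHS]big_mkcond [leRHS]big_seq; apply: ler_sum => N' N'I.
    have rr := arc_length_le nn nn' NI N'I.
    have r'0 : 0 < arc_length n' N' by exact: arc_length_gt0.
    rewrite /overlap; case: ifPn => [/andP[h1 h2]|_]; last by case: ifP => // _; exact: ltW.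
    rewrite ifT ?ge_min ?lexx ?orbT//; apply/andP; split; lra.
  rewrite big_filter_cond [leLHS]big_mkcond [leRHS]big_mkcond; apply: ler_sum => N' _.
  case: ifPn => [/andP[_ ->]//|_]; case: ifP => // _.
  by rewrite ltW// arc_length_gt0.
rewrite -mulr_sumr -mulrA ler_wpM2l// big_split /= -mulr_sumr.
have h1 := mass_le (u n) (v n) m (q0 n) (spaced_denominator n0) (L1 nn) K68 abq.
have h2 := size_level_seq_le (u n) m (q0 n) (spaced_denominator n0) (ve nn) abq.
have h3 : \sum_(N <- levels n a b) (q n')%:R^-1 <=
    3 * (b - a) * ((q n.+1)%:R / (q n')%:R).
  rewrite -[X in \sum_(_ <- _) X]mul1r -mulr_suml mulrA ler_pM2r ?invr_gt0//.
  apply: (le_trans h2); have ab : 0 <= b - a.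
    by rewrite -(pmulr_lge0 _ (qR0 n)); exact: le_trans ler01 abq.
  by rewrite ler_wpM2l ?mulr_ge0// ler_nat; exact: eq.
rewrite [leRHS]mulrDr; apply: lerD; last by rewrite mulrCA mulrA.
rewrite (_ : _ * (12 * _) = 4 * (3 * (b - a) * w n)); last by ring.
by rewrite ler_pM2l.
Qed.

(** Arcs of one level are disjoint, since their starts are 1 / (2 e) apart and their lengths at most
    1 / (4 e); only the diagonal terms remain. *)
Lemma overlap_same n a b : (n1 <= n)%N -> 1 <= (b - a) * (q n)%:R ->
  \sum_(N <- levels n a b) \sum_(N' <- levels n a b)
    overlap (c N) (arc_length n N) (c N') (arc_length n N') <=
  3 * (b - a) * w n.
Proof.
move=> nn abq.
have n0 : (0 < n)%N by exact: leq_trans nn.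
apply: le_trans (mass_le (u n) (v n) m (q0 n) (spaced_denominator n0) (L1 nn) K68 abq).
rewrite big_seq [leRHS]big_seq; apply: ler_sum => N NI.
have us : uniq (levels n a b) by rewrite filter_uniq// iota_uniq.
rewrite (bigD1_seq N)//= [X in _ + X]big_seq_cond big1 ?addr0.
  by rewrite /overlap; case: ifP => _; rewrite ?minxx// ltW// arc_length_gt0.
move=> N' /andP[N'I N'N].
have [/andP[_ Nv] _ jN _] := level_seqP NI.
have [/andP[_ N'v] _ jN' _] := level_seqP N'I.
have sep := level_separated (spe nn) (ve nn) Nv N'v; rewrite eq_sym N'N in sep.
have {}sep := sep isT.
have rN := block_length_le (q0 n) (L1 nn) (e0 nn) (eL nn) K68 jN.
have rN' := block_length_le (q0 n) (L1 nn) (e0 nn) (eL nn) K68 jN'.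
have E2 : (2 * (e n)%:R)^-1 = (4 * (e n)%:R)^-1 + (4 * (e n)%:R)^-1 :> R.
  by field; rewrite pnatr_eq0 -lt0n e0.
have E0 : 0 < (4 * (e n)%:R)^-1 :> R by rewrite invr_gt0 mulr_gt0// ltr0n e0.
rewrite /overlap /arc_length ifF//; apply: contraTF sep => /andP[h1 h2].
by rewrite -ltNge E2 ltr_norml; apply/andP; split; lra.
Qed.

Lemma arc_length_ge0 n N : 0 <= arc_length n N.
Proof.
rewrite invr_ge0 !mulr_ge0 ?ler0n//; first by exact: le_trans K68.
by rewrite ln_ge0// ler1n.
Qed.

Lemma sum_denominator_ratio_le (n0 n2 n' : nat) :
  \sum_(n0 <= n < n2) (if (n < n')%N then (q n.+1)%:R / (q n')%:R else 0) <= 3 :> R.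
Proof.
rewrite -big_mkcond -mulr_suml ler_pdivrMr//.
apply: (@le_trans _ _ (\sum_(0 <= n < n') (q n.+1)%:R)).
  rewrite -big_filter; apply: ler_sum_sub; rewrite ?filter_uniq ?iota_uniq// => n.
  by rewrite mem_filter !mem_index_iota => /andP[].
by rewrite -natr_sum -natrM ler_nat sum_denominator.
Qed.

(** With l = b - a and S the sum of the weights, the second moment method applies with A = l S / 2.
    Pairs within a level give 3 l S, pairs of levels 12 l S^2, and the rounding terms 9 l S for each
    order of the two levels. As S >= 1 the total is at most B = 33 l S^2, and A^2 / B = l / 132. *)
Lemma union_mass_ge (a b : R) (n0 n2 : nat) (U : set R) :
  0 <= a -> b <= 1 -> (n1 <= n0)%N ->
  (forall n, (n0 <= n)%N -> 2 * (6 + m%:R) <= (b - a) * (q n)%:R) ->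
  1 <= \sum_(n0 <= n < n2) w n -> measurable U ->
  (forall n N, (n0 <= n < n2)%N -> N \in levels n a b -> arc_of (n, N) `<=` U) ->
  (((b - a) / 132)%:E <= mu U)%E.
Proof.
move=> a0 b1 n10 big S1 mU FU.
set S := \sum_(_ <= _ < _) _ in S1; set l := b - a in big *.
have l0 : 0 < l.
  rewrite -(pmulr_lgt0 _ (qR0 n0)); apply: lt_le_trans (big n0 (leqnn _)).
  by rewrite mulr_gt0// ltr_pwDl.
have abq n : (n0 <= n)%N -> 1 <= l * (q n)%:R.
  by move=> /big; apply: le_trans; have : 0 <= m%:R :> R by []; lra.
have nn n : n \in index_iota n0 n2 -> (n1 <= n)%N /\ (n0 <= n)%N.
  by rewrite mem_index_iota => /andP[nn _]; split => //; exact: leq_trans nn.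
have w0 n : n \in index_iota n0 n2 -> 0 <= w n.
  by move=> /nn[n1n _]; apply: level_weight_sum_ge0 => //; exact: L1.
pose s := [seq (n, N) | n <- index_iota n0 n2, N <- levels n a b].
pose o (x y : nat * nat) := overlap (c x.2) (arc_length x.1 x.2)
  (c y.2) (arc_length y.1 y.2).
pose bb n n' := \sum_(N <- levels n a b) \sum_(N' <- levels n' a b) o (n, N) (n', N').
pose G n n' : R := w n' * l * 3 * (if (n < n')%N then (q n.+1)%:R / (q n')%:R else 0).
have bbC n n' : bb n n' = bb n' n.
  by rewrite /bb exchange_big; apply: eq_bigr => N' _; apply: eq_bigr => N _; exact: overlapC.
have G0 n n' : n' \in index_iota n0 n2 -> 0 <= G n n'.
  by move=> /w0 w'0; rewrite !mulr_ge0 ?(ltW l0)//; case: ifP.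
have bb_lt n n' : n \in index_iota n0 n2 -> n' \in index_iota n0 n2 -> (n < n')%N ->
    bb n n' <= 12 * l * (w n * w n') + G n n'.
  move=> nI n'I nn'; have [n1n n0n] := nn n nI.
  apply: (le_trans (overlap_cross n1n nn' (abq n n0n))).
  by rewrite /G nn' /l le_eqVlt; apply/orP; left; apply/eqP; ring.
have bb_ne n n' : n \in index_iota n0 n2 -> n' \in index_iota n0 n2 -> n' != n ->
    bb n n' <= 12 * l * (w n * w n') + (G n n' + G n' n).
  move=> nI n'I; rewrite neq_ltn => /orP[n'n|nn'].
    rewrite bbC (le_trans (bb_lt _ _ n'I nI n'n))// [w n' * w n]mulrC lerD2l.
    by rewrite lerDr G0.
  by rewrite (le_trans (bb_lt _ _ nI n'I nn'))// lerD2l lerDl G0.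
have sumG : \sum_(n0 <= n < n2) \sum_(n0 <= n' < n2) G n n' <= 9 * l * S.
  rewrite exchange_big /= mulr_sumr big_seq [leRHS]big_seq.
  apply: ler_sum => n' n'I; rewrite -mulr_sumr.
  apply: (@le_trans _ _ (w n' * l * 3 * 3)).
    rewrite ler_wpM2l ?sum_denominator_ratio_le//.
    by rewrite !mulr_ge0 ?(ltW l0)//; exact: w0.
  by rewrite le_eqVlt; apply/orP; left; apply/eqP; ring.
have sumbb : \sum_(n0 <= n < n2) \sum_(n0 <= n' < n2) bb n n' <= 33 * l * S ^+ 2.
  apply: (@le_trans _ _ (\sum_(n0 <= n < n2) (3 * l * w n +
    \sum_(n0 <= n' < n2) (12 * l * (w n * w n') + (G n n' + G n' n))))).
    rewrite big_seq [leRHS]big_seq; apply: ler_sum => n nI.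
    have [n1n n0n] := nn n nI.
    rewrite (bigD1_seq n) ?iota_uniq//=; apply: lerD.
      exact: (overlap_same n1n (abq n n0n)).
    rewrite big_mkcond /= big_seq [leRHS]big_seq; apply: ler_sum => n' n'I.
    case: ifP => [nn'|_]; first exact: bb_ne.
    by rewrite !addr_ge0 ?G0// !mulr_ge0 ?(ltW l0) ?w0.
  rewrite big_split /= -mulr_sumr -/S.
  have -> : \sum_(n0 <= n < n2) \sum_(n0 <= n' < n2)
      (12 * l * (w n * w n') + (G n n' + G n' n)) =
    12 * l * S ^+ 2 + (\sum_(n0 <= n < n2) \sum_(n0 <= n' < n2) G n n' +
    \sum_(n0 <= n < n2) \sum_(n0 <= n' < n2) G n n').
    under eq_bigr do rewrite big_split /= -mulr_sumr -mulr_sumr -/S big_split /=.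
    rewrite big_split /= -mulr_sumr -mulr_suml -/S expr2 big_split /=.
    by congr (_ + (_ + _)); rewrite exchange_big.
  have SS : l * S <= l * S ^+ 2 by rewrite ler_pM2l// expr2 ler_peMl//; lra.
  have -> : 33 * l * S ^+ 2 = 33 * (l * S ^+ 2) by ring.
  have -> : 12 * l * S ^+ 2 = 12 * (l * S ^+ 2) by ring.
  have -> : 3 * l * S = 3 * (l * S) by ring.
  have h9 : 9 * l * S = 9 * (l * S) by ring.
  by rewrite h9 in sumG; lra.
have -> : l / 132 = (l / 2 * S) ^+ 2 / (33 * l * S ^+ 2).
  by field; rewrite !gt_eqF// (lt_le_trans _ S1).
apply: (@second_moment R _ s arc_of U _ _ (fun x => arc_length x.1 x.2) o) => //.
- by move=> x; exact: measurable_arc.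
- move=> _ /allpairsPdep[n [N [nI NI ->]]]; apply: FU => //.
  by rewrite mem_index_iota in nI.
- by move=> x; exact/mu_arc/arc_length_ge0.
- rewrite big_allpairs_dep /= mulr_sumr big_seq [leRHS]big_seq.
  apply: ler_sum => n nI; have [n1n n0n] := nn n nI.
  have [c1 _] := convergent_approx alpha01 alpha_irr n.
  exact: (mass_ge (u n) (v n) (q0 n) (coprime_convergent alpha n) c1 (L1 n1n) K68 a0 b1 (big n n0n)).
- by move=> x y; apply: mu_overlap; exact: arc_length_ge0.
- apply: le_trans sumbb; rewrite big_allpairs_dep /= big_seq [leRHS]big_seq.
  apply: ler_sum => n nI; rewrite exchange_big /= big_allpairs_dep /=.
  rewrite le_eqVlt; apply/orP; left; apply/eqP; apply: eq_bigr => n' _.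
  by rewrite exchange_big.
- by rewrite mulr_ge0// ?divr_ge0// ?(ltW l0)// (le_trans _ S1).
- have S0 : 0 < S by exact: lt_le_trans S1.
  by apply: mulr_gt0; [apply: mulr_gt0 | apply: exprn_gt0].
Qed.

End level_family.

(** * A criterion for an infinite limsup *)

Section divergence_criterion.
Variables (R : realType) (alpha : R) (u v e : nat -> nat) (n1 : nat).
Hypotheses (alpha01 : 0 < alpha < 1) (alpha_irr : irrational alpha).

Local Notation q := (denominator alpha).
Local Notation mu := (@lebesgue_measure R).
Local Notation c := (arc_start alpha).

Hypotheses (n1_gt0 : (0 < n1)%N)
  (L1 : forall n, (n1 <= n)%N -> 1 <= ln (q n)%:R :> R)
  (ve : forall n, (n1 <= n)%N -> (v n * q n <= e n)%N)
  (e0 : forall n, (n1 <= n)%N -> (0 < e n)%N)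
  (eq : forall n, (n1 <= n)%N -> (e n <= q n.+1)%N)
  (spe : forall n, (n1 <= n)%N -> spaced alpha (e n) (2 * (e n)%:R)^-1)
  (eL : forall n, (n1 <= n)%N -> forall j, (u n <= j < v n)%N ->
    (e n)%:R * (1 + ln j.+1%:R) <= 2 * (j.+1%:R * (q n)%:R * ln (q n)%:R) :> R).

Lemma frac_arc_start (x : R) N : 0 <= x - c N < 1 ->
  frac (x + N%:R * alpha) = x - c N.
Proof.
move=> xc; apply: (@frac_eq _ _ _ (- Num.floor (N%:R * - alpha))) => //.
by rewrite /arc_start /frac intrN; ring.
Qed.

Lemma denominator_mul_ge (l : R) (M : R) : 0 < l -> exists n0, forall n, (n0 <= n)%N ->
  M <= l * (q n)%:R.
Proof.
move=> l0; exists (Num.truncn (M / l)).+1 => n nn.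
rewrite mulrC -ler_pdivrMr// (le_trans (ltW (truncnS_gt _)))// ler_nat.
by rewrite (leq_trans nn)// leq_denominator_id.
Qed.

Definition level_arcs (K : R) (m : nat) : set R :=
  \bigcup_(x in [set x : nat * nat | (n1 <= x.1)%N /\ (m <= x.2)%N /\
    (u x.1 * q x.1 <= x.2 < v x.1 * q x.1)%N]) arc_of alpha K x.

Lemma measurable_level_arcs K m : measurable (level_arcs K m).
Proof.
rewrite /level_arcs bigcup_mkcond; apply: countable_bigcupT_measurable => // x.
by case: ifP => // _; exact: measurable_arc.
Qed.

(** On an arc x + N alpha is just after 0, and [phi_return_ge] applies with b = j + 1. The index
    [m.+1] ensures N > 0, hence a positive denominator S_N. *)
Lemma level_arcs_return (C : R) (m : nat) (x : R) : 1 <= C -> 0 < x < 1 ->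
  level_arcs (68 * C) m.+1 x -> exists2 N, (m <= N)%N &
  C <= phi (iter N (rotation alpha) x) / birkhoff_sum alpha phi N x.
Proof.
move=> C1 /andP[x0 x1] [[n N] /= [n1n [mN /andP[uN Nv]]]].
have q0 := denominator_gt0 alpha01 alpha_irr n.
have n0 : (0 < n)%N by exact: leq_trans n1n.
have K68 : 68 <= 68 * C by rewrite ler_peMr.
rewrite /arc_of /arc /= in_itv /= => /andP[cx xc].
pose j := (N %/ q n)%N.
have jv : (u n <= j < v n)%N by rewrite leq_divRL// ltn_divLR// uN Nv.
have /andP[c0 c1] : 0 <= c N < 1 by exact: frac_itv.
have x01 : 0 <= x < 1 by rewrite x1 ltW.
have fE : frac (x + N%:R * alpha) = x - c N.
  by apply: frac_arc_start; apply/andP; split; lra.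
exists N; first exact: ltnW.
rewrite iter_rotation// birkhoff_sumE//.
set S := \sum_(_ <= _ < _) _.
have S0 : 0 < S.
  rewrite /S big_ltn//; last exact: leq_ltn_trans mN.
  rewrite ltr_pwDl ?phi_gt0 ?frac_itv// sumr_ge0// => k _.
  by rewrite ltW// phi_gt0// frac_itv.
rewrite ler_pdivlMr//.
apply: (@phi_return_ge R alpha (q n) j.+1 N (e n)%:R q0) => //.
- by rewrite ltr0n e0.
- by rewrite ltnW// ltn_ceil.
- exact: spaced_denominator.
- move=> k mz /andP[k0 kN]; apply: spe => //; rewrite k0 /=.
  by apply: leq_trans (ve n1n); exact: leq_trans Nv.
- exact: L1.
- exact: eL.
- by rewrite fE subr_gt0 cx /= lerBlDl ltW.
Qed.

Hypothesis divergent : forall (M : R) (n0 : nat), exists n2,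
  M <= \sum_(n0 <= n < n2) \sum_(u n <= j < v n) (j.+1%:R * ln (q n)%:R)^-1.

Lemma ae_level_arcs (K : R) (m : nat) : 68 <= K ->
  {ae mu, forall x : R, 0 < x < 1 -> level_arcs K m x}.
Proof.
move=> K68; have K0 : 0 < K by exact: lt_le_trans K68.
apply: (@ae_of_uniform_density _ _ (1 / 264)) => //.
  exact: measurable_level_arcs.
(* Only arcs that start in the left half are used: their length is at most 1 / q_n <= a' - a, so
   they remain inside the interval. This turns 132 into 264. *)
move=> a b a0 ab b1; pose a' := (a + b) / 2.
have l0 : 0 < a' - a by rewrite /a'; lra.
have [n0 n0P] := denominator_mul_ge (2 * (6 + m%:R)) l0.
pose n3 := maxn n0 n1.
(* The sums in [divergent] are K times the weights, so exceeding K gives weights of sum at least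
   1. *)
have [n2 n2P] := divergent K n3.
have -> : 1 / 264 * (b - a) = (a' - a) / 132 by rewrite /a'; field.
apply: (@union_mass_ge _ alpha u v e n1 m K alpha01 alpha_irr n1_gt0 K68 L1 ve e0
  eq spe eL a a' n3 n2).
- exact: ltW.
- by rewrite /a'; lra.
- exact: leq_maxr.
- by move=> n nn; apply: n0P; apply: leq_trans nn; exact: leq_maxl.
- rewrite -(ler_pM2l K0) mulr1 (le_trans n2P)// mulr_sumr big_seq [leRHS]big_seq.
  apply: ler_sum => n; rewrite mem_index_iota => /andP[nn _].
  rewrite mulr_sumr; apply: ler_sum => j _.
  have n1n : (n1 <= n)%N by apply: leq_trans nn; exact: leq_maxr.
  have qR0 : (0 : R) < (q n)%:R by rewrite ltr0n denominator_gt0.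
  have L0 : 0 < ln (q n)%:R :> R by exact: lt_le_trans (L1 n1n).
  rewrite /block_length le_eqVlt; apply/orP; left; apply/eqP.
  by field; rewrite !gt_eqF.
- apply: measurableI; [exact: measurable_level_arcs | exact: measurable_itv].
- move=> n N /andP[nn _] NI.
  have n1n : (n1 <= n)%N by apply: leq_trans nn; exact: leq_maxr.
  have q0 := denominator_gt0 alpha01 alpha_irr n.
  have qR0 : (0 : R) < (q n)%:R by rewrite ltr0n.
  have [uNv mN jv /andP[aN Na']] := level_seqP alpha01 alpha_irr NI.
  move=> x xarc; split; first by exists (n, N).
  move: xarc; rewrite /arc_of /arc /= !in_itv /= => /andP[cx xc].
  have rE := block_length_le q0 (L1 n1n) (e0 n1n) (eL n1n) K68 jv.
  have qe : (q n)%:R <= (e n)%:R :> R.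
    rewrite ler_nat (leq_trans _ (ve n1n))// leq_pmull//.
    by case/andP: jv => _; exact: leq_ltn_trans.
  have rq : arc_length alpha K n N <= (q n)%:R^-1.
    apply: (le_trans rE); rewrite lef_pV2 ?posrE ?mulr_gt0 ?ltr0n ?e0//; lra.
  have ql : (q n)%:R^-1 <= a' - a.
    rewrite -[leLHS]mul1r ler_pdivrMr//.
    apply: le_trans (n0P n _); last by apply: leq_trans nn; exact: leq_maxl.
    by have : 0 <= m%:R :> R by []; lra.
  have a'E : a' + (a' - a) = b by rewrite /a'; field.
  by apply/andP; split; lra.
Qed.

Lemma limsup_ratio_eqy :
  {ae mu, forall x : R, x \in `[0, 1[ -> limsup_ratio alpha x = +oo%E}.
Proof.
have ae_arcs : {ae mu, forall x : R, forall k m : nat,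
    0 < x < 1 -> level_arcs (68 * k.+1%:R) m x}.
  apply: ae_foralln => k; apply: ae_foralln => m; apply: ae_level_arcs.
  by rewrite ler_peMr// ler1n.
have F := ae_filter_ringOfSetsType mu.
move: (ae_orbit_frac_gt0 alpha) ae_arcs; apply: filterS2 => x x0 xarc.
rewrite in_itv /= => x01; apply: limn_esup_eqy => C m.
have {}x01 : 0 < x < 1.
  case/andP: (x01) => _ ->; have := x0 0%N.
  by rewrite mul0r addr0 frac_id// => ->.
pose k := Num.truncn C.
have k1 : 1 <= k.+1%:R :> R by rewrite ler1n.
have [N mN CN] := level_arcs_return k1 x01 (xarc k m.+1 x01).
by exists N => //; apply: le_trans CN; rewrite ltW// truncnS_gt.
Qed.

End divergence_criterion.

(** * Comparison of the arc lengths with W *)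

Section divergent_weights.
Variable R : realType.

Definition harmonic_weight (q u v : nat) : R :=
  \sum_(u <= j < v) (j.+1%:R * ln q%:R)^-1.

Lemma harmonic_weight_ge (q u v : nat) : 0 < ln q%:R :> R ->
  (ln v.+1%:R - ln u.+1%:R) / ln q%:R <= harmonic_weight q u v.
Proof.
move=> L0; have [uv|vu] := leqP u v.
  rewrite /harmonic_weight; under eq_bigr do rewrite invfM.
  by rewrite -mulr_suml ler_pM2r ?invr_gt0// ln_ge_harmonic.
rewrite /harmonic_weight big_geq ?(ltnW vu)// mulr_le0_ge0 ?invr_ge0 ?(ltW L0)//.
by rewrite subr_le0 ler_ln ?posrE ?ltr0Sn// ler_nat ltnS ltnW.
Qed.

(* From the block P (1 + ln P) on, N ln q dominates q' ln(N / q). *)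
Definition window_start (q q' : nat) : nat :=
  let P : R := q'%:R / (q%:R * ln q%:R) in
  if q'%:R < 2 * q%:R * ln q%:R :> R then 0%N else Num.truncn (P * (1 + ln P)).

(** If q' < 2 q ln q, then 1 + ln (j + 1) <= j + 1 suffices. Otherwise write j + 1 = P t, where t >=
    1 + ln P; then 1 + ln P + ln t <= 2 t. *)
Lemma window_start_sound (q q' j : nat) : (0 < q <= q')%N -> 1 <= ln q%:R :> R ->
  (window_start q q' <= j)%N ->
  q'%:R * (1 + ln j.+1%:R) <= 2 * (j.+1%:R * q%:R * ln q%:R) :> R.
Proof.
move=> /andP[q0 qq'] L1; have qR0 : (0 : R) < q%:R by rewrite ltr0n.
have L0 : 0 < ln q%:R :> R by exact: lt_le_trans L1.
have j0 : (0 : R) < j.+1%:R by rewrite ltr0Sn.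
rewrite /window_start; set P := q'%:R / _; case: ifPn => [q'lt _|q'ge uj].
  have lnj : 1 + ln j.+1%:R <= j.+1%:R :> R.
    have := @le_ln1Dx R j%:R; rewrite [1 + j%:R]addrC natr1 => h.
    rewrite -[leRHS]natr1 addrC lerD2r h//.
    by rewrite (@lt_le_trans _ _ 0)// ltrN10.
  have lnj0 : 0 <= 1 + ln j.+1%:R :> R by rewrite addr_ge0// ln_ge0// ler1n.
  have -> : 2 * (j.+1%:R * q%:R * ln q%:R) = 2 * q%:R * ln q%:R * j.+1%:R :> R by ring.
  by apply: ler_pM => //; exact: ltW.
rewrite -leNgt in q'ge.
have P2 : 2 <= P by rewrite /P ler_pdivlMr ?mulr_gt0// mulrA.
have q'E : q'%:R = P * q%:R * ln q%:R.
  by rewrite /P; field; rewrite !gt_eqF.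
clearbody P.
have P0 : 0 < P by exact: lt_le_trans P2.
pose t := j.+1%:R / P.
have t0 : 0 < t by rewrite divr_gt0.
have jE : j.+1%:R = P * t :> R by rewrite /t; field; rewrite gt_eqF.
have tP : 1 + ln P <= t.
  rewrite /t ler_pdivlMr// mulrC ltW// (lt_le_trans (truncnS_gt _))//.
  by rewrite ler_nat.
have lnt := ln_sublinear t0.
rewrite q'E jE lnM ?posrE//.
have -> : 2 * (P * t * q%:R * ln q%:R) = P * q%:R * ln q%:R * (2 * t) by ring.
by rewrite ler_pM2l ?mulr_gt0//; lra.
Qed.

(** If q' < 2 q ln q, the window starts at 0 and its harmonic sum reaches ln (q' / q). Otherwise it
    starts at most at 4 P ln P and ends at a + 1 >= q' / q = P ln q, so its harmonic sum is at least
    ln ln q - ln ln P - 2. *)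
Lemma level_weight_le (q q' a : nat) : (0 < q <= q')%N -> 1 <= ln q%:R :> R ->
  (q' <= a.+1 * q)%N ->
  level_weight R q q' <=
  3 / ln q%:R + harmonic_weight q (window_start q q') a.
Proof.
move=> /andP[q0 qq'] L1 q'a; have qR0 : (0 : R) < q%:R by rewrite ltr0n.
have q'R0 : (0 : R) < q'%:R by rewrite ltr0n (leq_trans q0).
have L0 : 0 < ln q%:R :> R by exact: lt_le_trans L1.
have Qa : q'%:R / q%:R <= a.+1%:R :> R by rewrite ler_pdivrMr// -natrM ler_nat.
have lnQ : ln q'%:R - ln q%:R <= ln a.+1%:R :> R.
  by rewrite -ln_div ?posrE// ler_ln ?posrE ?divr_gt0 ?ltr0Sn.
have := harmonic_weight_ge (window_start q q') a L0.
set H := harmonic_weight q _ a; rewrite ler_pdivrMr// => hH.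
rewrite /level_weight; move: hH; rewrite /window_start.
set P := q'%:R / _; case: ifPn => [q'lt hH|q'ge hH].
  rewrite ler_pdivrMr// mulrDl mulfVK ?gt_eqF//.
  by rewrite ln1 subr0 in hH; lra.
rewrite -leNgt in q'ge.
have P2 : 2 <= P by rewrite /P ler_pdivlMr ?mulr_gt0// mulrA.
have q'E : q'%:R = P * q%:R * ln q%:R.
  by rewrite /P; field; rewrite !gt_eqF.
clearbody P.
have P0 : 0 < P by exact: lt_le_trans P2.
have /andP[ln2 ln2'] := ln2_bounds R.
have lnP : 2^-1 <= ln P by apply: (le_trans ln2); rewrite ler_ln ?posrE.
have lnP0 : 0 < ln P by lra.
set X := P * (1 + ln P) in hH.
have X0 : 0 <= X by rewrite mulr_ge0 ?(ltW P0)//; lra.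
have X4 : (Num.truncn X).+1%:R <= 4 * (P * ln P).
  have /truncn_itv/andP[h _] := X0.
  rewrite -natr1; have : 1 <= P * ln P by nra.
  have : P <= 2 * (P * ln P) by nra.
  by rewrite /X in h *; lra.
have lnX : ln (Num.truncn X).+1%:R <= 2 + (ln P + ln (ln P)).
  apply: (@le_trans _ _ (ln (4 * (P * ln P)))).
    by rewrite ler_ln ?posrE ?ltr0Sn// !mulr_gt0.
  rewrite lnM ?posrE ?mulr_gt0// lnM ?posrE// lerD2r.
  rewrite (_ : 4 = 2 * 2); last by rewrite -natrM.
  by rewrite lnM ?posrE//; lra.
have lnq' : ln q'%:R = ln P + ln q%:R + ln (ln q%:R).
  by rewrite q'E lnM ?posrE ?mulr_gt0// lnM ?posrE.
rewrite ler_pdivrMr// mulrDl mulfVK ?gt_eqF// ge_max.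
have H0 : 0 <= H.
  by rewrite sumr_ge0// => j _; rewrite invr_ge0 mulr_ge0// ltW.
have HL0 : 0 <= H * ln q%:R by rewrite mulr_ge0// ltW.
by apply/andP; split; lra.
Qed.

End divergent_weights.

Section dichotomy.
Variables (R : realType) (alpha : R).
Hypotheses (alpha01 : 0 < alpha < 1) (alpha_irr : irrational alpha).

Local Notation q := (denominator alpha).
Local Notation a := (partial_quotient alpha).
Local Notation mu := (@lebesgue_measure R).

(** The family of times N < q_n: the single block j = 0, with spacing scale e = q_n. *)
Lemma limsup_ratio_eqy_unit :
  (forall (M : R) (n0 : nat), exists n2, M <= \sum_(n0 <= n < n2) (ln (q n)%:R)^-1) ->
  {ae mu, forall x : R, x \in `[0, 1[ -> limsup_ratio alpha x = +oo%E}.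
Proof.
move=> div; have [n1 L1] := ln_denominator_ge alpha01 alpha_irr 1.
have L1' n : (maxn n1 1 <= n)%N -> 1 <= ln (q n)%:R :> R.
  by rewrite geq_max => /andP[/L1].
have n0 n : (maxn n1 1 <= n)%N -> (0 < n)%N by rewrite geq_max => /andP[].
apply: (@limsup_ratio_eqy R alpha (fun=> 0%N) (fun=> 1%N) q (maxn n1 1)) => //.
- by rewrite leq_max orbT.
- by move=> n _; rewrite mul1n.
- by move=> n _; exact: denominator_gt0.
- by move=> n _; exact: leq_denominatorS.
- by move=> n nn; apply: spaced_denominator => //; exact: n0.
- move=> n nn [|j]// _; rewrite ln1 addr0 mulr1 mul1r.
  have qR0 : (0 : R) < (q n)%:R by rewrite ltr0n denominator_gt0.
  have := L1' n nn; nra.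
- move=> M n2; have [n3 h] := div M n2; exists n3; apply: (le_trans h).
  by apply: ler_sum => n _; rewrite big_nat1 mul1r.
Qed.

(** The family of blocks from [window_start] up to a_(n+1), with spacing scale e = q_(n+1). *)
Lemma limsup_ratio_eqy_window :
  (forall (M : R) (n0 : nat), exists n2, M <= \sum_(n0 <= n < n2)
    harmonic_weight R (q n) (window_start R (q n) (q n.+1)) (a n.+1)) ->
  {ae mu, forall x : R, x \in `[0, 1[ -> limsup_ratio alpha x = +oo%E}.
Proof.
move=> div; have [n1 L1] := ln_denominator_ge alpha01 alpha_irr 1.
have L1' n : (maxn n1 1 <= n)%N -> 1 <= ln (q n)%:R :> R.
  by rewrite geq_max => /andP[/L1].
apply: (@limsup_ratio_eqy R alpha (fun n => window_start R (q n) (q n.+1))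
  (fun n => a n.+1) (fun n => q n.+1) (maxn n1 1)) => //.
- by rewrite leq_max orbT.
- by move=> n _; exact: leq_mul_denominator.
- by move=> n _; exact: denominator_gt0.
- by move=> n _ k mz kq; exact: best_approximation.
- move=> n nn j /andP[uj _]; apply: window_start_sound => //; last exact: L1'.
  by rewrite denominator_gt0// leq_denominatorS.
Qed.

Lemma W_sum_unbounded (n0 : nat) (B : R) : W_sum alpha = +oo%E ->
  (forall n, (n0 <= n)%N -> (2 <= q n)%N) ->
  ~ (forall n2, \sum_(n0 <= n < n2) W alpha n <= B).
Proof.
move=> Woo q2 WB.
pose W' n := if (2 <= q n)%N then W alpha n else 0.
have W'0 n : 0 <= W' n.
  rewrite /W'; case: ifP => // qn; apply: level_weight_ge0.
  by rewrite qn leq_denominatorS.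
pose H := \sum_(1 <= n < n0) W' n.
have part k : \sum_(1 <= n < k) W' n <= H + B.
  apply: (@le_trans _ _ (\sum_(n <- index_iota 1 n0 ++ index_iota n0 (maxn k n0)) W' n)).
    apply: ler_sum_sub => //; first exact: iota_uniq.
      rewrite cat_uniq !iota_uniq /= andbT; apply/hasPn => n.
      by rewrite !mem_index_iota => /andP[h _]; rewrite [(n < n0)%N]ltnNge h andbF.
    move=> n; rewrite mem_cat !mem_index_iota => /andP[-> nk] /=.
    by rewrite leq_max nk /= andbT; case: ltnP.
  rewrite big_cat /= lerD2l; apply: le_trans (WB (maxn k n0)).
  by apply: ler_sum_nat => n /andP[nn _]; rewrite /W' q2.
suff : (W_sum alpha <= (H + B)%:E)%E by rewrite Woo leye_eq.
rewrite /W_sum; apply: lime_le.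
  apply: is_cvg_nneseries => n _ qn; rewrite lee_fin.
  by have := W'0 n; rewrite /W' qn.
apply: nearW => k; rewrite big_mkcond /=.
rewrite (eq_bigr (fun n => (W' n)%:E)); first by rewrite sumEFin lee_fin.
by move=> n _; rewrite /W'; case: ifP.
Qed.

(** If neither family diverged, [level_weight_le] would bound the partial sums of W. *)
Lemma limsup_ratio_eqy_W_sum : W_sum alpha = +oo%E ->
  {ae mu, forall x : R, x \in `[0, 1[ -> limsup_ratio alpha x = +oo%E}.
Proof.
move=> Woo; have [n1 L1] := ln_denominator_ge alpha01 alpha_irr 1.
have [/limsup_ratio_eqy_unit//|/existsNP[M1 /existsNP[m1 /forallNP unit_le]]] :=
  pselect (forall (M : R) n0, exists n2, M <= \sum_(n0 <= n < n2) (ln (q n)%:R)^-1).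
apply: limsup_ratio_eqy_window => M2 m2.
apply: contrapT => /forallNP window_le.
pose n0 := maxn n1 (maxn 2 (maxn m1 m2)).
have n0P n : (n0 <= n)%N -> [/\ (n1 <= n)%N, (2 <= n)%N, (m1 <= n)%N & (m2 <= n)%N].
  by rewrite !geq_max => /and4P[].
have q2 n : (n0 <= n)%N -> (2 <= q n)%N.
  by move=> /n0P[_ n2 _ _]; rewrite (leq_trans n2)// leq_denominator_id.
apply: (@W_sum_unbounded n0 (3 * M1 + M2) Woo q2) => n2.
pose H n := harmonic_weight R (q n) (window_start R (q n) (q n.+1)) (a n.+1).
apply: (@le_trans _ _ (\sum_(n0 <= n < n2) (3 * (ln (q n)%:R)^-1 + H n))).
  apply: ler_sum_nat => n /andP[/n0P[n1n n2n _ _] _].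
  apply: level_weight_le; last by apply: ltn_denominator_mul => //; exact: ltnW.
    by rewrite denominator_gt0// leq_denominatorS.
  exact: L1.
have lnq0 n : 0 <= (ln (q n)%:R)^-1 :> R.
  by rewrite invr_ge0 ln_ge0// ler1n denominator_gt0.
have H0 n : 0 <= H n.
  by rewrite sumr_ge0// => j _; rewrite invfM mulr_ge0.
have tail (F : nat -> R) k : (forall n, 0 <= F n) -> (k <= n0)%N ->
    \sum_(n0 <= n < n2) F n <= \sum_(k <= n < n2) F n.
  move=> F0 kn; apply: ler_sum_sub => //; rewrite ?iota_uniq// => n.
  by rewrite !mem_index_iota => /andP[nn ->]; rewrite (leq_trans kn).
have [_ _ m1n m2n] := n0P n0 (leqnn _).
rewrite big_split /= -mulr_sumr lerD//.
  rewrite ler_pM2l// (le_trans (tail _ _ lnq0 m1n))// leNgt.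
  by apply/negP => /ltW/(unit_le n2).
rewrite (le_trans (tail _ _ H0 m2n))// leNgt.
by apply/negP => /ltW/(window_le n2).
Qed.

End dichotomy.

Theorem theorem1p1 (R : realType) (alpha : R)
    (alpha01 : 0 < alpha < 1) (alpha_irr : irrational alpha) :
  ((W_sum alpha < +oo)%E ->
    {ae lebesgue_measure, forall x : R,
      x \in `[0, 1[ -> limsup_ratio alpha x = 0%:E}) /\
  (W_sum alpha = +oo%E ->
    {ae lebesgue_measure, forall x : R,
      x \in `[0, 1[ -> limsup_ratio alpha x = +oo%E}).
Proof.
split=> [Wfin|Wdiv]; first exact: limsup_ratio_eq0.
exact: limsup_ratio_eqy_W_sum.
Qed.
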